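(* Let $\lambda$ be a partition and $L\subset\mathbb R^n$ a full-rank lattice which is strongly perfect with respect to $\lambda$. Then $L$ is extreme with respect to $\lambda$, i.e. $L$ is a local maximum of $\gamma$ on the space of full-rank lattices of $\mathbb R^n$. (In particular, $L$ is perfect and strongly eutactic with respect to $\lambda$.)
   Context: Let $\lambda$ be a partition whose conjugate partition $\breve\lambda=(\breve\lambda_1\ge\dots\ge\breve\lambda_{\breve s})$ has all parts $<n$; $|\lambda|=\sum\breve\lambda_i$; let $d_1>\dots>d_\ell$ be the distinct values of the $\breve\lambda_i$ and $d=(d_1,\dots,d_\ell)$. For a lattice $\Lambda$, $\det\Lambda$ is the Gram determinant of a basis. For a full-rank lattice $L\subset\mathbb R^n$, $\gamma(L)=\inf_\Lambda\frac{\det(\Lambda_1)\cdots\det(\Lambda_{\breve s})}{\det(L)^{|\lambda|/n}}$ over chains of nested sublattices $\Lambda=(\Lambda_1,\dots,\Lambda_{\breve s})$ of $L$ with $\mathrm{rk}\,\Lambda_i=\breve\lambda_i$; the chains attaining the infimum form the finite set $\mathscr S_\lambda(L)$ of minimal flags. $\Pi_\Lambda=\sum_i\mathrm{pr}_{\mathrm{span}\Lambda_i}$ (sum of orthogonal projections). $L$ is perfect w.r.t. $\lambda$ if the $\Pi_\Lambda$, $\Lambda\in\mathscr S_\lambda(L)$, span the space of symmetric endomorphisms of $\mathbb R^n$; eutactic if $\mathrm{Id}$ is a positive linear combination of them; strongly eutactic if it is such a combination with all coefficients equal; extreme if $\gamma$ attains a local maximum at $L$. $L$ is strongly perfect w.r.t.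 $\lambda$ if the set of flags of subspaces of shape $d$ determined by the minimal flags (spans of the $\Lambda_i$) is a vexillar $4$-design in $\mathscr D_d$. Here $\mathscr D_d$ is the variety of flags $\{0\}\subsetneq V_\ell\subsetneq\dots\subsetneq V_1\subsetneq\mathbb R^n$, $\dim V_i=d_i$, with $\mathbf O(n)$-invariant probability measure; with $m=d_1$ a flag is represented by $X_\Delta\in M_{n\times m}(\mathbb R)$ with orthonormal columns whose first $d_i$ columns span $V_i$, unique up to right multiplication by the block diagonal group $\mathbf O(d_\ell)\times\mathbf O(d_{\ell-1}-d_\ell)\times\dots\times\mathbf O(d_1-d_2)$; polynomial functions of degree $\le t$ on $\mathscr D_d$ are $\Delta\mapsto P(X_\Delta)$ with $P$ a polynomial of degree $\le t$ in the matrix entries invariant under that group; a vexillar $t$-design is a finite $\mathcal D\subset\mathscr D_d$ with $\int_{\mathscr D_d}f=\frac1{|\mathcal D|}\sum_{\Delta\in\mathcal D}f(\Delta)$ for all such $f$. *)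

(* Defs.v *)
From HB Require Import structures.
From mathcomp Require Import all_boot all_order all_algebra.
From mathcomp Require Import all_classical all_reals all_analysis.

Set Implicit Arguments.
Unset Strict Implicit.
Unset Printing Implicit Defensive.

Import Order.TTheory GRing.Theory Num.Theory.
Import numFieldNormedType.Exports.

Local Open Scope classical_set_scope.
Local Open Scope ring_scope.

Section LatticeDefs.
Variable R : realType.

Definition zspan (k n : nat) (C : 'M[R]_(k, n)) : set 'rV[R]_n :=
  [set v | exists z : 'rV[int]_k, v = map_mx (fun x : int => x%:~R) z *m C].

Definition rspan (k n : nat) (C : 'M[R]_(k, n)) : set 'rV[R]_n :=
  [set v | exists w : 'rV[R]_k, v = w *m C].

Definition lattice_of (n : nat) (B : 'M[R]_n) : set 'rV[R]_n := zspan B.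

Definition gram_det (k n : nat) (C : 'M[R]_(k, n)) : R := \det (C *m C^T).

(* orthogonal projection (acting on row vectors by v |-> v *m P) onto the
   row space of a row-free matrix C *)
Definition proj_rows (k n : nat) (C : 'M[R]_(k, n)) : 'M[R]_n :=
  C^T *m invmx (C *m C^T) *m C.

Variables (n : nat) (lamc : seq nat).
(* lamc = the conjugate partition (breve lambda_1 >= ... >= breve lambda_s) *)

Definition part (i : 'I_(size lamc)) : nat := nth 0%N lamc i.

(* a chain of sublattices, given by a basis C i of each Lambda_i *)
Definition chainT := forall i : 'I_(size lamc), 'M[R]_(part i, n).

Definition sublats (C : chainT) : 'I_(size lamc) -> set 'rV[R]_n :=
  fun i => zspan (C i).

Definition is_chain (B : 'M[R]_n) (C : chainT) : Prop :=
  (forall i, row_free (C i)) /\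
  (forall i, zspan (C i) `<=` lattice_of B) /\
  (forall i j : 'I_(size lamc), (i <= j)%N -> zspan (C j) `<=` zspan (C i)).

Definition chain_value (B : 'M[R]_n) (C : chainT) : R :=
  (\prod_i gram_det (C i)) / (gram_det B `^ ((sumn lamc)%:R / n%:R)).

Definition gamma (B : 'M[R]_n) : R :=
  inf [set r | exists C, is_chain B C /\ r = chain_value B C].

Definition minimal_chain (B : 'M[R]_n) (C : chainT) : Prop :=
  is_chain B C /\ chain_value B C = gamma B.

Definition PiC (C : chainT) : 'M[R]_n := \sum_i proj_rows (C i).

Definition perfect (B : 'M[R]_n) : Prop :=
  forall M : 'M[R]_n, M^T = M ->
  exists (k : nat) (Cs : 'I_k -> chainT) (a : 'I_k -> R),
    (forall j, minimal_chain B (Cs j)) /\ M = \sum_j a j *: PiC (Cs j).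

Definition strongly_eutactic (B : 'M[R]_n) : Prop :=
  exists (k : nat) (Cs : 'I_k -> chainT) (c : R),
    0 < c /\
    (forall j, minimal_chain B (Cs j)) /\
    (forall j j', sublats (Cs j) = sublats (Cs j') -> j = j') /\
    (forall C, minimal_chain B C -> exists j, sublats (Cs j) = sublats C) /\
    1%:M = c *: \sum_j PiC (Cs j).

(* local maximum of gamma on the space of full-rank lattices; the topology
   of that space is the quotient topology from bases *)
Definition extreme (B : 'M[R]_n) : Prop :=
  exists e : R, 0 < e /\
    forall B' : 'M[R]_n, B' \in unitmx ->
      (forall i j, `|B' i j - B i j| < e) -> gamma B' <= gamma B.

Definition mdim : nat := nth 0%N lamc 0.

Definition orthonormal_cols (X : 'M[R]_(n, mdim)) : Prop := X^T *m X = 1%:M.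

Definition colspan_first (X : 'M[R]_(n, mdim)) (k : nat) : set 'rV[R]_n :=
  [set v | exists w : 'rV[R]_mdim,
     (forall j : 'I_mdim, (k <= j)%N -> w 0 j = 0) /\ v = w *m X^T].

(* the flag represented by X, listed along the parts of breve lambda
   (V_j is repeated for each i with breve lambda_i = d_j) *)
Definition flag_of_frame (X : 'M[R]_(n, mdim)) : 'I_(size lamc) -> set 'rV[R]_n :=
  fun i => colspan_first X (part i).

Definition flag_of_chain (C : chainT) : 'I_(size lamc) -> set 'rV[R]_n :=
  fun i => rspan (C i).

(* i and j lie in the same diagonal block of
   O(d_l) x O(d_{l-1}-d_l) x ... x O(d_1-d_2) *)
Definition same_block (i j : 'I_mdim) : Prop :=
  forall k, k \in lamc -> (i < k)%N = (j < k)%N.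

Definition block_group (h : 'M[R]_mdim) : Prop :=
  h^T *m h = 1%:M /\ (forall i j, ~ same_block i j -> h i j = 0).

Definition poly_fun (deg : nat) (P : 'M[R]_(n, mdim) -> R) : Prop :=
  exists (k : nat) (c : 'I_k -> R) (e : 'I_k -> 'I_n -> 'I_mdim -> nat),
    (forall l, (\sum_i \sum_j e l i j <= deg)%N) /\
    forall X, P X = \sum_l c l * \prod_i \prod_j X i j ^+ e l i j.

Definition block_invariant (P : 'M[R]_(n, mdim) -> R) : Prop :=
  forall h X, block_group h -> P (X *m h) = P X.

Definition mxBorel := g_sigma_algebraType (@open 'M[R]_(n, mdim)).

Definition stiefel_invariant (mu : probability mxBorel R) : Prop :=
  mu [set X : mxBorel | orthonormal_cols X] = 1%E /\
  forall g : 'M[R]_n, g^T *m g = 1%:M ->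
    forall A : set mxBorel, measurable A ->
      mu ((fun X : mxBorel => (g *m X : mxBorel)) @^-1` A) = mu A.

(* the flags determined by the minimal flags of L(B) form a vexillar
   4-design: Xs j (j < k) are orthonormal frames representing, without
   repetition, exactly the flags determined by the minimal flags *)
Definition strongly_perfect (B : 'M[R]_n) : Prop :=
  exists (k : nat) (Xs : 'I_k -> 'M[R]_(n, mdim)),
    (forall j, orthonormal_cols (Xs j)) /\
    (forall j, exists C, minimal_chain B C /\ flag_of_frame (Xs j) = flag_of_chain C) /\
    (forall C, minimal_chain B C -> exists j, flag_of_frame (Xs j) = flag_of_chain C) /\
    (forall j j', flag_of_frame (Xs j) = flag_of_frame (Xs j') -> j = j') /\
    forall mu : probability mxBorel R, stiefel_invariant mu ->
      forall P : 'M[R]_(n, mdim) -> R, poly_fun 4 P -> block_invariant P ->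
        (\int[mu]_X (P X)%:E)%E = ((k%:R)^-1 * \sum_j P (Xs j))%:E.

End LatticeDefs.

(* Main.v *)
(* Averaging a block-invariant polynomial of degree at most 4 over the design equals its
   O(n)-invariant integral, so the sum over the minimal flags of P(g X) does not depend on
   the orthogonal matrix g. With P(X) = tr(Pi_X A) the sum of the Pi_X commutes with O(n),
   hence is scalar (eutaxy). With P(X) = tr(Pi_X A)^2, a symmetric A orthogonal to all Pi_X
   stays so after conjugation by O(n); as Pi_X is singular and nonzero this forces A = 0
   (perfection). For this the invariant measure on the Stiefel manifold must exist: it is
   the image under Gram-Schmidt of Lebesgue measure on a bounded O(n)-invariant set of
   n x m matrices.

   Extremality is Voronoi's argument. For a nearby lattice B T, normalised so that
   A = T T^T = 1 + H with tr H = 0, the inequality log det P <= tr P - k bounds the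
   logarithm of the value of a minimal chain, relative to its value at B, by
   tr(Pi H) + (|lambda|/n) tr(H^2 A^-1). By perfection and eutaxy some minimal chain has
   tr(Pi H) <= - d |H|, which beats the quadratic term. *)

Require Import Defs.
From HB Require Import structures.
From mathcomp Require Import all_boot all_order all_algebra perm zify ring lra.
From mathcomp Require Import all_classical all_reals all_analysis measurable_realfun.
Set Implicit Arguments.
Unset Strict Implicit.
Unset Printing Implicit Defensive.
Import Order.TTheory GRing.Theory Num.Theory.
Import numFieldNormedType.Exports.
Local Open Scope classical_set_scope.
Local Open Scope ring_scope.

(** * Invariant measure on the Stiefel manifold *)

(** The design hypothesis speaks of every O(n)-invariant probability measure, so nothing follows
    from it until one is exhibited. Squares of traces have degree 4 and are nonnegative, which turns
    a statement about a sum over the design into one about each of its members. Pi is singular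
    because the flags are proper; were Pi a multiple of the identity, every trace-free A would stay
    orthogonal to Pi under conjugation.

    Strong eutaxy sums over minimal chains of lattices, whereas a design sums over flags. The two
    sums agree because a minimal chain is primitive: each of its lattices is the intersection of L
    with its span, so the flag determines the chain.

    In Voronoi's argument the constant d comes from coefficients that express the symmetrised matrix
    units through the Pi. This replaces compactness of the unit sphere and leaves an explicit
    neighbourhood of B. *)

Definition matB (R : realType) (n m : nat) := g_sigma_algebraType (@open 'M[R]_(n, m)).

Lemma measurable_entry (R : realType) (n m : nat) i j :
  measurable_fun setT (fun X : matB R n m => (X : 'M[R]_(n, m)) i j).
Proof.
apply: (measurability _ (@RGenOpens.measurableE R)).
move=> _ [_ [a [b ->] <-]]; rewrite setTI.
apply: sub_sigma_algebra.
apply: open_comp; last exact: interval_open.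
by move=> X _; exact: coord_continuous.
Qed.

(** Every open set is a countable union of boxes with rational centre and radius the inverse of a
    positive integer, and the preimage of a box involves finitely many entries. *)
Lemma measurable_matP (R : realType) (n m : nat) d (T : measurableType d) (f : T -> matB R n m) :
  (forall i j, measurable_fun setT (fun x => (f x : 'M[R]_(n, m)) i j)) ->
  measurable_fun setT f.
Proof.
move=> mf; apply: (@measurability _ _ T (matB R n m) setT f (@open 'M[R]_(n, m))) => //.
move=> _ [U oU <-]; rewrite setTI.
pose box (p : 'M[rat]_(n, m) * nat) : set 'M[R]_(n, m) :=
  [set X | forall i j, `|ratr (p.1 i j) - X i j| < p.2.+1%:R^-1].
pose F (p : 'M[rat]_(n, m) * nat) : set T :=
  if `[< box p `<=` U >] then f @^-1` box p else set0.
have -> : f @^-1` U = \bigcup_p F p.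
  apply/seteqP; split => [x Ux | x [p _]]; last first.
    rewrite /F; case: asboolP => // pU Fx; exact: pU.
  have := open_nbhs_nbhs (conj oU Ux).
  move=> /nbhs_ballP[e /= e0 He].
  (* Radius below [e / 2]: points of the box are within two radii of [f x], so the box lies in the
     ball. *)
  have [k ke] : exists k : nat, k.+1%:R^-1 < e / 2.
    have /ltr_add_invr[k Hk] : 0 < e / 2 by rewrite divr_gt0.
    by exists k; rewrite add0r in Hk.
  have k0 : (0 : R) < k.+1%:R^-1 by rewrite invr_gt0 ltr0n.
  have rat_near (y : R) : exists q : rat, `|ratr q - y| < k.+1%:R^-1.
    have [|q] := @rat_in_itvoo R (y - k.+1%:R^-1) (y + k.+1%:R^-1).
      by rewrite ltrBlDr -addrA ltrDl addr_gt0.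
    by rewrite in_itv /= => qy; exists q; rewrite ltr_distl.
  pose q : 'M[rat]_(n, m) := \matrix_(i, j) sval (cid (rat_near ((f x : 'M[R]_(n, m)) i j))).
  exists (q, k) => //; rewrite /F.
  have qx : box (q, k) (f x) by move=> i j; rewrite mxE; exact: (svalP (cid (rat_near _))).
  case: asboolP => // -[] Y Yq; apply: He; split => // i j.
  rewrite /ball /=.
  have := ler_distD (ratr (q i j)) ((f x : 'M[R]_(n, m)) i j) (Y i j).
  move=> /le_lt_trans; apply.
  rewrite distrC [ltRHS]splitr ltrD //.
    by apply: lt_trans ke; exact: qx.
  by apply: lt_trans ke; exact: Yq.
apply: countable_bigcupT_measurable => [|p]; first exact: countableP.
rewrite /F; case: asboolP => // _.
have -> : f @^-1` box p = \bigcap_(ij in [set: 'I_n * 'I_m])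
     ((fun x => (f x : 'M[R]_(n, m)) ij.1 ij.2) @^-1`
       (ball (ratr (p.1 ij.1 ij.2) : R) p.2.+1%:R^-1)).
  by apply/seteqP; split => x H; [move=> ij _; exact: H|move=> i j; exact: (H (i, j) Logic.I)].
apply: fin_bigcap_measurable => // ij _.
rewrite -[X in measurable X]setTI; apply: mf => //; exact: measurable_ball.
Qed.

Lemma ex_pushforward_measure d1 d2 (T1 : measurableType d1) (T2 : measurableType d2)
  (R : realType) (mu : {measure set T1 -> \bar R}) (phi : T1 -> T2) :
  measurable_fun setT phi ->
  exists nu : {measure set T2 -> \bar R}, forall A, nu A = mu (phi @^-1` A).
Proof.
by move=> mphi; unshelve refine (ex_intro _ (pushforward mu phi : {measure set T2 -> \bar R}) _).
Qed.

(** Lebesgue measure is determined by its values on half-open intervals, and [|a|] times its image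
    under [t |-> s + a * t] has the same values. *)
Lemma integral_lebesgue_affine (R : realType) (f : R -> \bar R) (a s : R) :
  a != 0 -> measurable_fun [set: R] f -> (forall x, 0%E <= f x)%E ->
  (\int[lebesgue_measure]_t f (s + a * t)%R = (`|a|^-1)%R%:E * \int[lebesgue_measure]_t f t)%E.
Proof.
move=> a0 mf f0.
pose phi : R -> R := fun t => s + a * t.
have mphi : measurable_fun [set: measurableTypeR R] (phi : measurableTypeR R -> measurableTypeR R).
  apply: measurable_funD => //; exact: measurable_funM.
have na0 : 0 <= `|a| by [].
have [nu nuE] := ex_pushforward_measure (@lebesgue_measure R) mphi.
have Hm : forall A, measurable A -> lebesgue_measure A = mscale (NngNum na0) nu A.
  apply: lebesgue_measure_unique => _ [[x y] _ <-] /=.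
  rewrite /mscale /= nuE.
  have [a1|a1|a1] := ltgtP 0 a; last by rewrite -a1 eqxx in a0.
    have -> : phi @^-1` `]x, y] = `](x - s) / a, (y - s) / a]%classic.
      apply/seteqP; split => t; rewrite /phi /= !in_itv /=
        ltr_pdivrMr// ler_pdivlMr// ltrBlDl lerBrDl mulrC//.
    apply: (etrans (lebesgue_measure_itv _)); apply/esym.
    apply: (etrans (congr1 (fun z => (`|a|%:E * z)%E) (lebesgue_measure_itv _))); apply/esym.
    rewrite /= !lte_fin.
    rewrite ltr_pM2r ?invr_gt0// ltrD2r.
    case: ifP => _; last by rewrite mule0.
    rewrite -!EFinB -EFinM gtr0_norm//; congr EFin; field.
    by [].
  have -> : phi @^-1` `]x, y] = `[(y - s) / a, (x - s) / a[%classic.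
    apply/seteqP; split => t; rewrite /phi /= !in_itv /=
      ltr_ndivlMr// ler_ndivrMr// ltrBlDl lerBrDl mulrC andbC//.
  apply: (etrans (lebesgue_measure_itv _)); apply/esym.
  apply: (etrans (congr1 (fun z => (`|a|%:E * z)%E) (lebesgue_measure_itv _))); apply/esym.
  rewrite /= !lte_fin.
  rewrite ltr_nM2r ?invr_lt0// ltrD2r.
  case: ifP => _; last by rewrite mule0.
  rewrite -!EFinB -EFinM ltr0_norm//; congr EFin; field.
  by [].
have mfp : measurable_fun [set: measurableTypeR R] (f : measurableTypeR R -> \bar R) by [].
have -> : (\int[lebesgue_measure]_t f (s + a * t)%R = \int[nu]_t f t)%E.
  have H := ge0_integral_pushforward mphi (@lebesgue_measure R) measurableT mfp (fun y _ => f0 y).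
  apply/esym/(etrans _ H); exact: eq_measure_integral.
have -> : (\int[lebesgue_measure]_t f t = \int[mscale (NngNum na0) nu]_t f t)%E.
  by apply: eq_measure_integral => A mA _; exact: Hm.
rewrite ge0_integral_mscale// muleA -EFinM mulVf ?mul1e// normr_eq0//.
Qed.

Lemma integral_lebesgue_shift (R : realType) (f : R -> \bar R) (s : R) :
  measurable_fun [set: R] f -> (forall x, 0%E <= f x)%E ->
  (\int[lebesgue_measure]_t f (s + t)%R = \int[lebesgue_measure]_t f t)%E.
Proof.
move=> mf f0; have := integral_lebesgue_affine s (oner_neq0 _) mf f0.
rewrite normr1 invr1 mul1e => <-.
by apply: eq_integral => t _; rewrite mul1r.
Qed.

(** * Lebesgue integration of matrix functions, one entry at a time *)

Section EntryIntegrals.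
Context {R : realType} {n m : nat}.
Local Notation M := 'M[R]_(n, m).
Local Notation idx := ('I_n * 'I_m)%type.
Implicit Types (f : matB R n m -> \bar R) (p q : idx) (X : M).

Definition nonneg_measurable f :=
  measurable_fun setT f /\ forall X, (0 <= f X)%E.

(** Entry [p] is integrated out, but the result is kept as a function of the whole matrix, constant
    in direction [p]; integrals over different entries then compose as operators. *)
Definition entry_int p f : matB R n m -> \bar R :=
  fun X => (\int[lebesgue_measure]_t f ((X : M) + t *: delta_mx p.1 p.2)%R)%E.

Definition entries_int (s : seq idx) f := foldr entry_int f s.

Lemma measurable_mat_shift d (T : measurableType d) p (g : T -> matB R n m)
    (h : T -> measurableTypeR R) :
  measurable_fun setT g -> measurable_fun setT h ->
  measurable_fun setT (fun y => ((g y : M) + (h y : R) *: delta_mx p.1 p.2 : matB R n m)).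
Proof.
move=> mg mh; apply: measurable_matP => i j; rewrite /=.
under eq_fun do rewrite !mxE.
apply: measurable_funD; last exact: measurable_funM.
exact: (measurableT_comp (measurable_entry i j) mg).
Qed.

Lemma measurable_line p X (f : matB R n m -> \bar R) :
  measurable_fun setT f ->
  measurable_fun [set: measurableTypeR R]
    (fun t : measurableTypeR R => f (X + (t : R) *: delta_mx p.1 p.2)).
Proof.
move=> mf; apply: (measurableT_comp mf).
exact: (measurable_mat_shift p (g := cst (X : matB R n m))).
Qed.

Lemma entry_int_nonneg_measurable p f :
  nonneg_measurable f -> nonneg_measurable (entry_int p f).
Proof.
move=> [mf f0]; split; last by move=> X; apply: integral_ge0.
apply: (@measurable_fun_fubini_tonelli_F _ _ (matB R n m) (measurableTypeR R) R lebesgue_measure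
  (fun y => f ((y.1 : M) + (y.2 : R) *: delta_mx p.1 p.2))).
  by apply: (measurableT_comp mf); exact: measurable_mat_shift.
by move=> y; exact: f0.
Qed.

Lemma entries_int_nonneg_measurable s f :
  nonneg_measurable f -> nonneg_measurable (entries_int s f).
Proof. by move=> nf; elim: s => //= p s; exact: entry_int_nonneg_measurable. Qed.

Lemma entry_intC p q f : nonneg_measurable f ->
  entry_int p (entry_int q f) = entry_int q (entry_int p f).
Proof.
move=> [mf f0]; apply/funext => X; rewrite /entry_int.
have := @fubini_tonelli _ _ (measurableTypeR R) (measurableTypeR R) R lebesgue_measure lebesgue_measure
  (fun y => f (X + (y.1 : R) *: delta_mx p.1 p.2 + (y.2 : R) *: delta_mx q.1 q.2)).
move=> ->; first by apply: eq_integral => y _; apply: eq_integral => x _; rewrite addrAC.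
- apply: (measurableT_comp mf); apply: measurable_mat_shift => //.
  exact: (measurable_mat_shift p (g := cst (X : matB R n m))).
- by move=> y; exact: f0.
Qed.

Lemma entries_int_cat s1 s2 f :
  entries_int (s1 ++ s2) f = entries_int s1 (entries_int s2 f).
Proof. by rewrite /entries_int foldr_cat. Qed.

Lemma entries_int_perm s1 s2 f : nonneg_measurable f ->
  perm_eq s1 s2 -> entries_int s1 f = entries_int s2 f.
Proof.
move=> nf; elim: s1 s2 => [|p s1 IH] s2.
  by rewrite perm_sym => /perm_nilP ->.
move=> pe; have ps2 : p \in s2 by rewrite -(perm_mem pe) mem_head.
move: pe; case/splitPr: ps2 => s3 s4.
rewrite -cat1s -(cat1s p s4) perm_sym perm_catCA perm_cat2l perm_sym => /IH /= ->.
elim: s3 => //= q s3 <-; rewrite entry_intC //; exact: entries_int_nonneg_measurable.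
Qed.

(** The one-variable substitution rule. Letting [q] differ from [p] covers permutations of rows,
    with [a = 1], as well as operations that rescale a row. *)
Lemma entry_int_affine p q f a (g : M -> M) : a != 0 -> nonneg_measurable f ->
  (forall X t, g (X + t *: delta_mx p.1 p.2) = g X + (a * t) *: delta_mx q.1 q.2) ->
  forall X, (entry_int p (f \o g) X = (`|a|^-1)%R%:E * entry_int q f (g X))%E.
Proof.
move=> a0 [mf f0] gE X; rewrite /entry_int.
have := @integral_lebesgue_affine R (fun t => f (g X + t *: delta_mx q.1 q.2)) a 0 a0.
move=> <- //; last exact: measurable_line.
by apply: eq_integral => t _ /=; rewrite gE add0r.
Qed.

Lemma entry_int_shift p f X s : nonneg_measurable f ->
  entry_int p f (X + s *: delta_mx p.1 p.2) = entry_int p f X.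
Proof.
move=> [mf f0]; rewrite /entry_int.
rewrite -[RHS](@integral_lebesgue_shift R (fun t => f (X + t *: delta_mx p.1 p.2)) s) //.
  by apply: eq_integral => t _; rewrite scalerDl addrA.
exact: measurable_line.
Qed.

Lemma entry_intZ p f c : 0 <= c -> nonneg_measurable f ->
  entry_int p (fun X => c%:E * f X)%E = (fun X => c%:E * entry_int p f X)%E.
Proof.
move=> c0 [mf f0]; apply/funext => X; rewrite /entry_int ge0_integralZl_EFin //.
by exact: measurable_line.
Qed.

Lemma entries_intZ s f c : 0 <= c -> nonneg_measurable f ->
  entries_int s (fun X => c%:E * f X)%E = (fun X => c%:E * entries_int s f X)%E.
Proof.
move=> c0 nf; elim: s => //= p s ->; rewrite entry_intZ //; exact: entries_int_nonneg_measurable.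
Qed.

Lemma entry_int_nneseries p (f : nat -> matB R n m -> \bar R) :
  (forall k, nonneg_measurable (f k)) ->
  entry_int p (fun X => \sum_(0 <= k <oo) f k X)%E =
  (fun X => \sum_(0 <= k <oo) entry_int p (f k) X)%E.
Proof.
move=> nf; apply/funext => X; rewrite /entry_int integral_nneseries //.
  by move=> k; exact: measurable_line (nf k).1.
by move=> k t _; exact: (nf k).2.
Qed.

Lemma entries_int_nneseries s (f : nat -> matB R n m -> \bar R) :
  (forall k, nonneg_measurable (f k)) ->
  entries_int s (fun X => \sum_(0 <= k <oo) f k X)%E =
  (fun X => \sum_(0 <= k <oo) entries_int s (f k) X)%E.
Proof.
move=> nf; elim: s => //= p s ->; rewrite entry_int_nneseries // => k.
exact: entries_int_nonneg_measurable.
Qed.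

Lemma indic_nonneg_measurable (A : set (matB R n m)) : measurable A ->
  nonneg_measurable (fun X => (\1_A X)%:E).
Proof.
move=> mA; split; first exact/measurable_EFinP/measurable_indic.
by move=> X; rewrite lee_fin.
Qed.

Definition box (A : M) (e : R) : set (matB R n m) :=
  [set X | forall i j, (X : M) i j \in `[A i j - e, A i j + e]].

(** The indicator of a box is a product of one-variable indicators, so the integrals separate. This
    serves both for upper bounds and for positivity of the measure of a region. *)
Lemma entries_int_box A e : 0 < e ->
  entries_int (enum {: idx}) (fun X => (\1_(box A e) X)%:E) 0 = ((2 * e) ^+ #|{: idx}|)%:E.
Proof.
move=> e0.
pose I (p : idx) : set R := `[A p.1 p.2 - e, A p.1 p.2 + e]%classic.
pose g (s : seq idx) : matB R n m -> \bar R :=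
  fun X => (\prod_(p <- s) \1_(I p) ((X : M) p.1 p.2))%:E.
have ng s : nonneg_measurable (g s).
  split; last by move=> X; rewrite lee_fin; apply: prodr_ge0.
  apply/measurable_EFinP; apply: measurable_prod => p _.
  apply: measurableT_comp (measurable_entry p.1 p.2).
  by apply: measurable_indic; exact: measurable_itv.
have Ig (s : seq idx) : uniq s ->
    entries_int s (g s) = fun=> ((2 * e) ^+ size s)%:E.
  elim: s => [|p s IH] /=.
    by move=> _; apply/funext => X; rewrite /g big_nil.
  move=> /andP[pns us]; rewrite -cat1s -[RHS]/(fun=> ((2 * e) ^+ (size s).+1)%:E).
  rewrite -[entry_int _ _]/(entries_int ([:: p] ++ s) (g (p :: s))).
  (* Entry [p] is moved to the innermost integral, where the remaining factors are constants. *)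
  have pc : perm_eq ([:: p] ++ s) (s ++ [:: p]) by rewrite perm_catC.
  rewrite (entries_int_perm (ng (p :: s)) pc) entries_int_cat.
  change (entries_int s (entry_int p (g (p :: s))) = (fun=> ((2 * e) ^+ (size s).+1)%:E)).
  have -> : entry_int p (g (p :: s)) = fun X => ((2 * e)%:E * g s X)%E.
    apply/funext => X; rewrite /entry_int /g.
    have E t : (\prod_(q <- p :: s) \1_(I q) ((X + t *: delta_mx p.1 p.2 : M) q.1 q.2) : R)
       = (\prod_(q <- s) \1_(I q) (X q.1 q.2)) * \1_(I p) (X p.1 p.2 + t).
      rewrite big_cons mulrC; congr (_ * _).
        apply: eq_big_seq => q qs; rewrite !mxE.
        have -> : (q.1 == p.1) && (q.2 == p.2) = false.
          apply/negbTE; apply: contra pns => /andP[/eqP q1 /eqP q2].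
          by rewrite (surjective_pairing p) -q1 -q2 -surjective_pairing.
        by rewrite mulr0 addr0.
      by rewrite !mxE !eqxx mulr1.
    under eq_integral do rewrite E EFinM.
    rewrite ge0_integralZl_EFin //; last 2 first.
    - apply/measurable_EFinP; apply: measurableT_comp (measurable_indic _) _ => //.
        exact: measurable_itv.
      exact: measurable_funD.
    - by apply: prodr_ge0.
    rewrite (@integral_lebesgue_shift R (fun t => (\1_(I p) t)%:E)); last 2 first.
    - by apply/measurable_EFinP; apply: measurable_indic; exact: measurable_itv.
    - by move=> x; rewrite lee_fin.
    rewrite integral_indic ?setIT //; last exact: measurable_itv.
    have E2 : lebesgue_measure (I p) = (2 * e)%:E.
      apply: (etrans (lebesgue_measure_itv _)); rewrite /= lte_fin.
      have -> : A p.1 p.2 - e < A p.1 p.2 + e by lra.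
      by rewrite -EFinB; congr EFin; ring.
    by rewrite muleC; congr (_ * _)%E; exact: E2.
  rewrite entries_intZ //; last by lra.
  by rewrite IH //; apply/funext => X; rewrite -EFinM -exprS.
have -> : (fun X => (\1_(box A e) X)%:E) = g (enum {: idx}).
  apply/funext => X; rewrite /g indicE; congr EFin.
  have [BX|BX] := pselect (box A e X).
  - rewrite (mem_set BX) big1_seq // => p _; rewrite indicE mem_set // /I /=; exact: BX.
  - rewrite (memNset BX); have [p pX] : exists p : idx, ~ I p (X p.1 p.2).
      apply: contra_notP BX => /forallNP H i j.
      by have := H (i, j) => /contrapT.
    by rewrite (big_rem p) ?mem_enum //= indicE memNset // mul0r.
rewrite Ig ?enum_uniq //= -cardE; congr EFin.
Qed.


Lemma measurable_mulmx d (T : measurableType d) (k l r : nat)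
    (F : T -> matB R k l) (G : T -> matB R l r) :
  measurable_fun setT F -> measurable_fun setT G ->
  measurable_fun setT (fun y => ((F y : 'M[R]_(k, l)) *m (G y : 'M[R]_(l, r)) : matB R k r)).
Proof.
move=> mF mG; apply: measurable_matP => i j; under eq_fun do rewrite mxE.
apply: measurable_sum => h; apply: measurable_funM.
  exact: (measurableT_comp (measurable_entry i h) mF).
exact: (measurableT_comp (measurable_entry h j) mG).
Qed.

Lemma measurable_trmx d (T : measurableType d) (k l : nat) (F : T -> matB R k l) :
  measurable_fun setT F ->
  measurable_fun setT (fun y => ((F y : 'M[R]_(k, l))^T : matB R l k)).
Proof.
move=> mF; apply: measurable_matP => i j; under eq_fun do rewrite mxE.
exact: (measurableT_comp (measurable_entry j i) mF).
Qed.

(** The value at 0 stands for a constant, since every entry has been integrated out. *)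
Definition mat_int f := entries_int (enum {: idx}) f 0.

(** The factor is [|det g| ^- m], but only its positivity is recorded; for orthogonal [g] it is
    identified later through an invariant region of finite positive measure. *)
Definition quasi_invariant (g : 'M[R]_n) :=
  exists2 c : R, 0 < c & forall f, nonneg_measurable f ->
    mat_int (fun X => f (g *m X)) = (c%:E * mat_int f)%E.

Lemma nonneg_measurable_mul (g : 'M[R]_n) f :
  nonneg_measurable f -> nonneg_measurable (fun X => f (g *m X)).
Proof.
move=> [mf f0]; split => //; apply: (measurableT_comp mf).
exact: (measurable_mulmx (F := cst (g : matB R n n))).
Qed.

Lemma quasi_invariant_mul (g h : 'M[R]_n) :
  quasi_invariant g -> quasi_invariant h -> quasi_invariant (g *m h).
Proof.
move=> [c c0 cg] [e e0 eh]; exists (e * c); first exact: mulr_gt0.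
move=> f nf; have := eh _ (nonneg_measurable_mul g nf).
rewrite cg // muleA -EFinM => <-; congr mat_int; apply/funext => X.
by rewrite mulmxA.
Qed.

Lemma quasi_invariant1 : quasi_invariant 1%:M.
Proof.
exists 1 => // f _; rewrite mul1e; congr mat_int; apply/funext => X.
by rewrite mul1mx.
Qed.

(** Adds the combination [b *m X] of all rows to row [i]. One shape covers transvections and
    dilations; its determinant is [1 + b 0 i]. *)
Definition row_op (i : 'I_n) (b : 'rV[R]_n) : 'M[R]_n :=
  1%:M + delta_mx i (0 : 'I_1) *m b.

Lemma row_op_mul i b k (X : 'M[R]_(n, k)) :
  row_op i b *m X = X + delta_mx i (0 : 'I_1) *m (b *m X).
Proof. by rewrite mulmxDl mul1mx mulmxA. Qed.

(** The Sherman-Morrison formula: the inverse of such a matrix has the same shape. *)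
Lemma row_op_inv i (b : 'rV[R]_n) : 1 + b 0 i != 0 ->
  row_op i (- (1 + b 0 i)^-1 *: b) *m row_op i b = 1%:M.
Proof.
move=> bi; rewrite row_op_mul /row_op mulmxDr mulmx1 mulmxA.
have -> : - (1 + b 0 i)^-1 *: b *m delta_mx i (0 : 'I_1) *m b
   = (- (1 + b 0 i)^-1 * b 0 i) *: b.
  rewrite -!scalemxAl -colE [col i b]mx11_scalar mxE mul_scalar_mx scalerA.
  by [].
rewrite -addrA -mulmxDr -!scalerDl.
rewrite -{1}[b]scale1r -!scalerDl.
have -> : 1 + (- (1 + b 0 i)^-1 + - (1 + b 0 i)^-1 * b 0 i) = 0 by field.
by rewrite scale0r mulmx0 addr0.
Qed.

Lemma entries_int_shift s f (p : idx) X t : p \in s -> nonneg_measurable f ->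
  entries_int s f (X + t *: delta_mx p.1 p.2) = entries_int s f X.
Proof.
move=> ps nf; rewrite (entries_int_perm nf (perm_to_rem ps)) /=.
by rewrite entry_int_shift //; exact: entries_int_nonneg_measurable.
Qed.

(* Integrate the entries of row [i] first: the result does not change when row [i] is
   translated, which absorbs [b *m X] and leaves the scaling by [1 + b 0 i]. *)
Lemma quasi_invariant_row_op i (b : 'rV[R]_n) : 1 + b 0 i != 0 -> quasi_invariant (row_op i b).
Proof.
set a := 1 + b 0 i => a0; pose g := row_op i b.
have gE X (j : 'I_m) t : g *m (X + t *: delta_mx i j) = g *m X + (a * t) *: delta_mx i j.
  rewrite mulmxDr; congr (_ + _); rewrite -scalemxAr /g row_op_mul.
  have -> : b *m delta_mx i j = b 0 i *: delta_mx (0 : 'I_1) j.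
    apply/matrixP => x y; rewrite !mxE (bigD1 i) //= big1 => [|k ki].
      by rewrite !mxE eqxx /= ord1 eqxx addr0.
    by rewrite mxE (negbTE ki) mulr0.
  rewrite -scalemxAr mul_delta_mx /a mulrC mulrDr mulr1 scalerDl scalerDr scalerA.
  by [].
pose si : seq idx := [seq (i, j) | j <- enum 'I_m].
pose sr := [seq p <- enum {: idx} | p \notin si].
have usi : uniq si by rewrite map_inj_uniq ?enum_uniq // => x y [].
have sE : perm_eq (enum {: idx}) (sr ++ si).
  apply: uniq_perm; first exact: enum_uniq.
    rewrite cat_uniq filter_uniq ?enum_uniq // usi andbT /=.
    by apply/hasPn => p psi; rewrite mem_filter psi.
  move=> p; rewrite mem_enum mem_cat mem_filter.
  by have -> : p \in enum {: idx}; rewrite ?mem_enum // andbT orNb.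
have step s f : nonneg_measurable f -> {subset s <= si} ->
    entries_int s (fun X => f (g *m X)) =
    fun X => (((`|a|^-1) ^+ size s)%:E * entries_int s f (g *m X))%E.
  move=> nf; elim: s => [|p s IH] ssi /=.
    by apply/funext => X; rewrite mul1e.
  rewrite IH => [|q qs]; last by apply: ssi; rewrite inE qs orbT.
  have c0 : 0 <= `|a|^-1 ^+ size s by rewrite exprn_ge0 // invr_ge0.
  rewrite (entry_intZ p c0 (nonneg_measurable_mul g (entries_int_nonneg_measurable s nf))).
  have /mapP[j _ pE] := ssi p (mem_head _ _).
  apply/funext => X; rewrite exprSr EFinM -muleA; congr (_ * _)%E.
  apply: (entry_int_affine (g := fun X => g *m X) a0).
    exact: entries_int_nonneg_measurable.
  by move=> Y t; rewrite pE; exact: gE.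
exists ((`|a|^-1) ^+ size si) => [|f nf]; first by rewrite exprn_gt0 // invr_gt0 normr_gt0.
rewrite /mat_int (entries_int_perm nf sE).
rewrite (entries_int_perm (nonneg_measurable_mul _ nf) sE) !entries_int_cat.
rewrite step //.
have -> : (fun X => (((`|a|^-1) ^+ size si)%:E * entries_int si f (g *m X))%E) =
  (fun X => (((`|a|^-1) ^+ size si)%:E * entries_int si f X)%E).
  apply/funext => X; congr (_ * _)%E; rewrite /g row_op_mul.
  have -> : delta_mx i (0 : 'I_1) *m (b *m X) =
     \sum_(j <- enum 'I_m) (b *m X) 0 j *: delta_mx i j.
    rewrite {1}[b *m X]row_sum_delta mulmx_sumr big_enum /=; apply: eq_bigr => j _.
    by rewrite -scalemxAr mul_delta_mx.
  have shift l (c : 'I_m -> R) Y :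
      entries_int si f (Y + \sum_(j <- l) c j *: delta_mx i j) = entries_int si f Y.
    elim: l Y => [|j l IH] Y; first by rewrite big_nil addr0.
    rewrite big_cons addrA IH; apply: (@entries_int_shift si f (i, j)) => //.
    by apply: map_f; rewrite mem_enum.
  exact: shift.
rewrite entries_intZ ?exprn_ge0 ?invr_ge0 //; exact: entries_int_nonneg_measurable.
Qed.

(** Swapping two rows only renames the entries, hence changes the order of integration. *)
Lemma quasi_invariant_tperm i k : quasi_invariant (tperm_mx i k).
Proof.
pose h (p : idx) : idx := (tperm i k p.1, p.2).
pose g : 'M[R]_n := tperm_mx i k.
have hK : involutive h by move=> [x y]; rewrite /h /= tpermK.
have gE p X t : g *m (X + t *: delta_mx p.1 p.2) = g *m X + (1 * t) *: delta_mx (h p).1 (h p).2.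
  rewrite mulmxDr mul1r; congr (_ + _); rewrite -scalemxAr; congr (_ *: _).
  rewrite /g /tperm_mx -row_permE; apply/matrixP => x y; rewrite !mxE /=.
  by rewrite (canF_eq (tpermK i k)).
have step s f : nonneg_measurable f ->
    entries_int s (fun X => f (g *m X)) = fun X => entries_int (map h s) f (g *m X).
  move=> nf; elim: s => [|p s IH] //=; rewrite IH; apply/funext => X.
  rewrite (entry_int_affine (g := fun X => g *m X) (oner_neq0 _) _ (gE p)).
    by rewrite normr1 invr1 mul1e.
  exact: entries_int_nonneg_measurable.
exists 1 => // f nf; rewrite mul1e /mat_int step // mulmx0.
rewrite (@entries_int_perm (map h (enum {: idx})) (enum {: idx})) //.
apply: uniq_perm; [|exact: enum_uniq|].
  by rewrite map_inj_uniq ?enum_uniq //; exact: inv_inj.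
move=> p; rewrite mem_enum -(hK p) map_f //; exact: mem_enum.
Qed.

(** Gaussian elimination, by induction on the number [k] of rows that need not yet be rows of the
    identity matrix. *)
Lemma quasi_invariant_unit (g : 'M[R]_n) : g \in unitmx -> quasi_invariant g.
Proof.
have key k : (k <= n)%N -> forall g : 'M[R]_n, g \in unitmx ->
    (forall i : 'I_n, (i < n - k)%N -> row i g = delta_mx 0 i) -> quasi_invariant g.
  elim: k => [|k IH] kn {}g gu gi.
    suff -> : g = 1%:M by exact: quasi_invariant1.
    by apply/row_matrixP => i; rewrite gi ?subn0 // row1.
  have sn : (n - k.+1 < n)%N by rewrite ltn_subrL (leq_ltn_trans _ kn).
  pose i0 := Ordinal sn; pose c := row i0 (invmx g).
  have cg : c *m g = delta_mx 0 i0 by rewrite /c -row_mul mulVmx // row1.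
  (* The rows of [g] above [i0] are unit vectors with entry 0 in column [i0]; they alone cannot
     combine to [delta_mx 0 i0]. *)
  have [h sh ch] : exists2 h : 'I_n, (i0 <= h)%N & c 0 h != 0.
    apply: contrapT => H.
    have c0 (h : 'I_n) : (i0 <= h)%N -> c 0 h = 0.
      by move=> ih; apply/eqP/negPn/negP => ch; apply: H; exists h.
    have := congr1 (fun z : 'rV[R]_n => z 0 i0) cg.
    rewrite !mxE !eqxx big1 => [/esym/eqP|h _]; first by rewrite oner_eq0.
    have [/c0 ->|hi] := leqP i0 h; first by rewrite mul0r.
    have := congr1 (fun z : 'rV[R]_n => z 0 i0) (gi h hi).
    rewrite !mxE => ->; have -> : (i0 == h) = false by apply/negbTE; rewrite neq_ltn hi orbT.
    by rewrite mulr0.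
  pose T : 'M[R]_n := tperm_mx i0 h.
  have TT : T *m T = 1%:M by rewrite /T /tperm_mx -perm_mxM tperm2 perm_mx1.
  pose c1 := c *m T.
  have c1i : c1 0 i0 = c 0 h.
    by rewrite /c1 /T /tperm_mx -[tperm i0 h]tpermV -col_permE mxE tpermL.
  (* Chosen so that [b *m (T *m g)] is [delta_mx 0 i0] minus row [i0] of [T *m g]: the row operation
     then puts the right unit vector in row [i0]. *)
  pose b : 'rV[R]_n := c1 - delta_mx 0 i0.
  have bi : 1 + b 0 i0 = c 0 h.
    rewrite -c1i /b mxE [(- _ : 'rV[R]_n) 0 i0]mxE [delta_mx _ _ _ _]mxE !eqxx /=; ring.
  have bi0 : 1 + b 0 i0 != 0 by rewrite bi.
  pose R' := row_op i0 b; pose d := - (1 + b 0 i0)^-1 *: b.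
  have RR : row_op i0 d *m R' = 1%:M by exact: row_op_inv.
  have di0 : 1 + d 0 i0 != 0.
    rewrite mxE (_ : _ + _ = (1 + b 0 i0)^-1) ?invr_neq0 //.
    by move: bi0; set z := b 0 i0; move=> zi; field.
  have -> : g = T *m (row_op i0 d *m (R' *m (T *m g))).
    by rewrite (mulmxA _ R') RR mul1mx mulmxA TT mul1mx.
  apply: quasi_invariant_mul; first exact: quasi_invariant_tperm.
  apply: quasi_invariant_mul; first exact: quasi_invariant_row_op.
  apply: IH; first exact: ltnW.
    rewrite !unitmx_mul gu (proj2 (mulmx1_unit RR)) (proj1 (mulmx1_unit TT)) //.
  move=> i ik.
  have bT : b *m (T *m g) = delta_mx 0 i0 - row i0 (T *m g).
    by rewrite mulmxBl /c1 -mulmxA (mulmxA T) TT mul1mx cg -rowE.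
  rewrite /R' row_op_mul bT linearD /= [row i (delta_mx _ _ *m _)]row_mul.
  have [->|ii0] := eqVneq i i0.
    rewrite (_ : row i0 (delta_mx i0 0) = 1%:M); last first.
      by apply/matrixP => x y; rewrite !mxE !ord1 !eqxx.
    by rewrite mul1mx addrC subrK.
  rewrite (_ : row i (delta_mx i0 0) = 0); last first.
    by apply/matrixP => x y; rewrite !mxE (negbTE ii0).
  rewrite mul0mx addr0.
  have ilt : (i < n - k.+1)%N.
    rewrite ltn_neqAle; apply/andP; split; first by apply: contra ii0 => /eqP e; apply/eqP/val_inj.
    by move: ik kn; clear; lia.
  rewrite -gi // /T /tperm_mx -row_permE; apply/matrixP => x y; rewrite !mxE.
  rewrite tpermD // eq_sym //.
  by apply: contraTneq sh => <-; rewrite -ltnNge.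
by move=> gu; apply: (key n) => // i; rewrite subnn.
Qed.

End EntryIntegrals.

(** * Gram-Schmidt and the invariant probability measure on frames *)

Section Haar.
Context {R : realType} {n m : nat}.
Local Notation M := 'M[R]_(n, m).

Lemma entries_int_ge0 s (f : matB R n m -> \bar R) :
  (forall X, 0 <= f X)%E -> forall X, (0 <= entries_int s f X)%E.
Proof. by move=> f0; elim: s => //= p s IH X; apply: integral_ge0. Qed.

Definition mat_lebesgue (A : set (matB R n m)) := mat_int (fun X => (\1_A X)%:E).

Lemma mat_lebesgue0 : mat_lebesgue set0 = 0%E.
Proof.
rewrite /mat_lebesgue /mat_int; under eq_fun do rewrite indic0.
suff E s : @entries_int R n m s (fun _ : matB R n m => 0%R%:E) =
  (fun _ : matB R n m => 0%R%:E) by rewrite E.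
elim: s => //= p s ->; apply/funext => X; rewrite /entry_int; exact: integral0.
Qed.

Lemma mat_lebesgue_ge0 A : (0 <= mat_lebesgue A)%E.
Proof. by apply: entries_int_ge0 => X; rewrite lee_fin. Qed.

Lemma mat_lebesgue_sigma_additive : semi_sigma_additive mat_lebesgue.
Proof.
move=> F mF tF mUF.
have -> : mat_lebesgue (\bigcup_k F k) = (\sum_(0 <= k <oo) mat_lebesgue (F k))%E.
  have := @entries_int_nneseries R n m (enum {: 'I_n * 'I_m}) (fun k X => (\1_(F k) X)%:E)
    (fun k => indic_nonneg_measurable (mF k)).
  move=> /(congr1 (fun F0 : matB R n m -> \bar R => F0 (0 : M))) <-.
  rewrite /mat_lebesgue /mat_int; congr (entries_int _ _ (0 : M)); apply/funext => X.
  by rewrite indic_bigcup.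
by apply: is_cvg_nneseries => k _ _; exact: mat_lebesgue_ge0.
Qed.

HB.instance Definition _ := isMeasure.Build _ _ _ mat_lebesgue
  mat_lebesgue0 mat_lebesgue_ge0 mat_lebesgue_sigma_additive.

Lemma mat_lebesgue_mul (g : 'M[R]_n) : g \in unitmx ->
  exists2 c : R, 0 < c & forall A : set (matB R n m), measurable A ->
    mat_lebesgue [set X : matB R n m | A (g *m (X : M))] = (c%:E * mat_lebesgue A)%E.
Proof.
move=> /quasi_invariant_unit -/(_ m) [c c0 cg]; exists c => // A mA.
rewrite /mat_lebesgue -cg //; exact: indic_nonneg_measurable.
Qed.

(** Column [k'] is made orthogonal to the columns already built and rescaled by the power [- 2^-1]
    of its squared norm; columns not yet treated are 0. There is no case distinction on [y], so
    measurability is read off the formula. *)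
Fixpoint gram_schmidt (k : nat) (X : M) : M :=
  if k is k'.+1 then
    let Q := gram_schmidt k' X in
    if insub k' is Some j then
      let y := col j X - Q *m (Q^T *m col j X) in
      Q + ((y^T *m y) 0 0 `^ (- 2^-1)) *: (y *m delta_mx (0 : 'I_1) j)
    else Q
  else 0.

Lemma measurable_gram_schmidt k :
  measurable_fun setT (fun X : matB R n m => (gram_schmidt k X : matB R n m)).
Proof.
elim: k => [|k IH] /=; first exact: measurable_cst.
case: insub => [j|//].
pose y (X : matB R n m) : 'cV[R]_n :=
  col j (X : M) - gram_schmidt k X *m ((gram_schmidt k X)^T *m col j (X : M)).
have mcol : measurable_fun setT (fun X : matB R n m => (col j (X : M) : matB R n 1)).
  apply: measurable_matP => a b; under eq_fun do rewrite mxE.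
  exact: measurable_entry.
have my : measurable_fun setT (fun X => y X : matB R n 1).
  have mprod := measurable_mulmx IH (measurable_mulmx (measurable_trmx IH) mcol).
  apply: measurable_matP => a b; rewrite /y; under eq_fun do rewrite mxE [X in _ + X]mxE.
  apply: measurable_funB.
    exact: (measurableT_comp (measurable_entry a b) mcol).
  exact: (measurableT_comp (measurable_entry a b) mprod).
apply: measurable_matP => a b.
under eq_fun do rewrite mxE [X in _ + X]mxE.
apply: measurable_funD; first exact: (measurableT_comp (measurable_entry a b) IH).
apply: measurable_funM.
  apply: (measurableT_comp (measurable_powR _)).
  exact: (measurableT_comp (measurable_entry 0 0) (measurable_mulmx (measurable_trmx my) my)).
have mp := measurable_mulmx my (G := cst (delta_mx (0 : 'I_1) j : matB R 1 m)) (measurable_cst _).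
exact: (measurableT_comp (measurable_entry a b) mp).
Qed.

Lemma gram_schmidt_equivariant (g : 'M[R]_n) k (X : M) :
  g^T *m g = 1%:M -> gram_schmidt k (g *m X) = g *m gram_schmidt k X.
Proof.
move=> gg; elim: k => [|k IH] /=; first by rewrite mulmx0.
case: insub => [j|//]; rewrite IH.
set Q := gram_schmidt k X.
have -> : col j (g *m X) - g *m Q *m ((g *m Q)^T *m col j (g *m X))
   = g *m (col j X - Q *m (Q^T *m col j X)).
  by rewrite !colE -!mulmxA trmx_mul -(mulmxA Q^T) (mulmxA g^T) gg mul1mx mulmxBr.
set y := col j X - _.
have -> : (g *m y)^T *m (g *m y) = y^T *m y.
  by rewrite trmx_mul mulmxA -(mulmxA y^T) gg mulmx1.
by rewrite [RHS]mulmxDr -scalemxAr mulmxA.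
Qed.

Lemma normsq_gt0 k (y : 'cV[R]_k) : y != 0 -> 0 < (y^T *m y) 0 0.
Proof.
move=> y0; rewrite mxE lt_neqAle eq_sym; apply/andP; split; last first.
  by apply: sumr_ge0 => i _; rewrite mxE -expr2 sqr_ge0.
apply: contra y0; rewrite psumr_eq0 => [/allP H|i _]; last by rewrite mxE -expr2 sqr_ge0.
apply/eqP/matrixP => i j; rewrite mxE ord1; apply/eqP.
by have := H i (mem_index_enum _); rewrite /= mxE mulf_eq0 orbb.
Qed.

(** The induction carries a [W] with [Q = X *m W] whose rows from [k] on vanish. The next vector [y]
    is then [X] times a vector with entry 1 at [j], and injectivity of [X] makes it nonzero. *)
Lemma gram_schmidt_orthonormal (X : M) :
  (forall w : 'cV[R]_m, X *m w = 0 -> w = 0) ->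
  (gram_schmidt m X)^T *m gram_schmidt m X = 1%:M /\
  exists W : 'M[R]_m, gram_schmidt m X = X *m W.
Proof.
move=> Xinj.
have key k : (k <= m)%N -> let Q := gram_schmidt k X in
  [/\ Q^T *m Q = \matrix_(a, b) ((a == b) && (a < k)%N)%:R,
      exists2 W : 'M[R]_m, Q = X *m W & forall a b : 'I_m, (k <= a)%N -> W a b = 0 &
      forall (a : 'I_n) (b : 'I_m), (k <= b)%N -> Q a b = 0].
  elim: k => [|k IH] km /=.
    split; last by move=> a b _; rewrite mxE.
      by rewrite mulmx0; apply/matrixP => a b; rewrite !mxE andbF.
    by exists 0 => [|a b _]; rewrite ?mulmx0 ?mxE.
  have [QQ [W QW W0] Q0] := IH (ltnW km); rewrite insubT /=.
  set Q := gram_schmidt k X in QQ QW Q0 *.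
  set j := Sub k km : 'I_m.
  have jk : j = k :> nat by [].
  set y := col j X - _.
  set c := _ `^ _.
  have yE : y = X *m (delta_mx j 0 - W *m (Q^T *m col j X)).
    by rewrite mulmxBr -colE (mulmxA X W) -QW.
  have y0 : y != 0.
    apply/eqP => y0; move: yE; rewrite y0 => /esym/Xinj /matrixP/(_ j 0) /eqP.
    rewrite !mxE !eqxx big1 ?subr0 ?oner_eq0 // => a _.
    by rewrite W0 ?jk // mul0r.
  have Ny := normsq_gt0 y0.
  have cc : c * c * (y^T *m y) 0 0 = 1.
    rewrite /c -powRD; last by apply/implyP => _; rewrite gt_eqF.
    rewrite (_ : - 2^-1 + - 2^-1 = -1); last by field.
    by rewrite powR_inv1 ?ltW // mulVf // gt_eqF.
  have Qy : Q^T *m y = 0.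
    rewrite mulmxBr (mulmxA Q^T Q) QQ.
    suff -> : (\matrix_(a, b) ((a == b) && (a < k)%N)%:R : 'M[R]_m) *m (Q^T *m col j X) =
        Q^T *m col j X.
      by rewrite subrr.
    apply/matrixP => a b; rewrite mxE (bigD1 a) //= big1 => [|a' aa'].
      rewrite !mxE eqxx /=; case: ltnP => ka /=; first by rewrite mul1r addr0.
      rewrite mul0r addr0 big1 // => h _; by rewrite mxE Q0 ?mul0r.
    by rewrite !mxE eq_sym (negbTE aa') mul0r.
  have yQ : y^T *m Q = 0 by rewrite -[LHS]trmxK trmx_mul trmxK Qy trmx0.
  split.
  - rewrite [(_ + _)^T]raddfD /= [(_ *: _)^T]linearZ /= trmx_mul trmx_delta mulmxDl !mulmxDr QQ.
    rewrite -!scalemxAr -!scalemxAl -!mulmxA (mulmxA Q^T) Qy mul0mx scaler0 addr0.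
    rewrite yQ mulmx0 scaler0 add0r scalerA.
    rewrite (mulmxA y^T) [y^T *m y]mx11_scalar mul_scalar_mx -scalemxAr scalerA cc scale1r.
    rewrite mul_delta_mx; apply/matrixP => a b; rewrite !mxE.
    have [->|ab] := eqVneq a b; last first.
      rewrite add0r; case: eqP => // aj; case: eqP => // bj.
      by case/eqP: ab; rewrite aj bj.
    rewrite andbb /= (_ : (b == j) = (b == k :> nat)) // ltnS.
    by case: (ltngtP b k) => //= _; rewrite ?addr0 ?add0r.
  - exists (W + c *: ((delta_mx j 0 - W *m (Q^T *m col j X)) *m delta_mx 0 j)).
      by rewrite mulmxDr -QW -scalemxAr (mulmxA X (_ - _)) -yE.
    move=> a b ka; rewrite mxE W0 ?(ltnW ka) // mxE [X in _ * X]mxE big1 ?mulr0 ?addr0 // => h _.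
    rewrite !mxE big1 => [|b' _]; last by rewrite W0 ?(ltnW ka) ?mul0r.
    have -> : (a == j) = false by apply/negbTE; rewrite -(inj_eq val_inj) /= neq_ltn ka orbT.
    by rewrite subr0 mul0r.
  - move=> a b kb; rewrite mxE Q0 ?(ltnW kb) // mxE [X in _ * X]mxE big1 ?mulr0 ?addr0 // => h _.
    rewrite !mxE.
    have -> : (b == j) = false by apply/negbTE; rewrite -(inj_eq val_inj) /= neq_ltn kb orbT.
    by rewrite andbF mulr0.
have [-> [W WE _] _] := key m (leqnn m); split; last by exists W.
by apply/matrixP => a b; rewrite !mxE ltn_ord andbT.
Qed.


Lemma gram_det_neq0 (X : M) :
  reflect (forall w : 'cV[R]_m, X *m w = 0 -> w = 0) (\det (X^T *m X) != 0).
Proof.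
apply: (iffP idP) => [dX w Xw|Xinj].
  have XX : X^T *m X *m w = 0 by rewrite -mulmxA Xw mulmx0.
  have XXu : X^T *m X \in unitmx by rewrite unitmxE unitfE.
  by rewrite -[w](mulKmx XXu) XX mulmx0.
apply/negP => /det0P[v v0 vX]; case/eqP: v0.
have Xv : X *m v^T = 0.
  apply/eqP/negPn/negP => /normsq_gt0.
  by rewrite trmx_mul trmxK -mulmxA (mulmxA X^T) mulmxA vX mul0mx mxE ltxx.
by apply: trmx_inj; rewrite trmx0; exact: Xinj.
Qed.

(** Both conditions involve only [X^T *m X], so the set is O(n)-invariant. The bound [4 * n * m]
    leaves room for all matrices with entries at most 2 in absolute value, hence for a box of radius
    at most 1 around [pid_mx m]. *)
Definition frame_region : set (matB R n m) :=
  [set X | \tr ((X : M)^T *m (X : M)) <= (4 * n * m)%:R /\ \det ((X : M)^T *m (X : M)) != 0].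

Lemma measurable_frame_region : measurable frame_region.
Proof.
have mXX : measurable_fun setT (fun X : matB R n m => ((X : M)^T *m (X : M) : matB R m m)).
  by apply: measurable_mulmx => //; exact: measurable_trmx.
have mtr : measurable_fun setT (fun X : matB R n m => \tr ((X : M)^T *m (X : M))).
  by apply: measurable_sum => i; exact: (measurableT_comp (measurable_entry i i) mXX).
have mdet : measurable_fun setT (fun X : matB R n m => \det ((X : M)^T *m (X : M))).
  apply: measurable_sum => s; apply: measurable_funM => //.
  by apply: measurable_prod => i _; exact: (measurableT_comp (measurable_entry i (s i)) mXX).
rewrite /frame_region; apply: measurableI.
  have := mtr measurableT `]-oo, (4 * n * m)%:R]%classic (measurable_itv _).
  rewrite setTI; congr measurable; apply/seteqP; split => X; by rewrite /= in_itv.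
have := mdet measurableT (~` [set 0]) (measurableC (measurable_set1 _)).
rewrite setTI; congr measurable; apply/seteqP; split => X /=; by move/eqP.
Qed.

Lemma tr_gram (X : M) : \tr (X^T *m X) = \sum_i \sum_j X j i ^+ 2.
Proof.
by apply: eq_bigr => i _; rewrite mxE; apply: eq_bigr => j _; rewrite mxE expr2.
Qed.

Lemma measurable_box A e : measurable (box A e : set (matB R n m)).
Proof.
have -> : box A e = \bigcap_(ij in [set: 'I_n * 'I_m])
   ((fun X : matB R n m => (X : M) ij.1 ij.2) @^-1` `[A ij.1 ij.2 - e, A ij.1 ij.2 + e]%classic).
  by apply/seteqP; split => X H; [move=> ij _; exact: H|move=> i j; exact: (H (i, j) Logic.I)].
apply: fin_bigcap_measurable => // ij _; rewrite -[X in measurable X]setTI.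
by apply: measurable_entry => //; exact: measurable_itv.
Qed.

Lemma frame_region_lty : (mat_lebesgue frame_region < +oo)%E.
Proof.
(* The summand 1 lets [z ^+ 2 <= B - 1] imply [z <= B] without a square root. *)
pose B : R := (4 * n * m)%:R + 1.
have B0 : 0 < B by rewrite ltr_wpDl.
apply: (@le_lt_trans _ _ (mat_lebesgue (box 0 B))).
  apply: le_measure; rewrite ?inE; [exact: measurable_frame_region|exact: measurable_box|].
  move=> X [trX _] i j; rewrite mxE sub0r add0r in_itv /= -ler_norml.
  have : X i j ^+ 2 <= B - 1.
    rewrite /B addrK; apply: le_trans trX; rewrite tr_gram (bigD1 j) //= (bigD1 i) //= -addrA lerDl.
    by rewrite addr_ge0 ?sumr_ge0 // => *; rewrite ?sumr_ge0 // => *; rewrite sqr_ge0.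
  rewrite -real_normK ?num_real //; set z := `|_| => Hz.
  have z0 : 0 <= z by exact: normr_ge0.
  nra.
by rewrite /mat_lebesgue /mat_int entries_int_box // ltry.
Qed.

Lemma frame_region_gt0 : (m <= n)%N -> (0 < mat_lebesgue frame_region)%E.
Proof.
(* With radius [1 / (m + 1)] the top [m] rows stay diagonally dominant: if [X *m w = 0], the l1 norm
   [t] of [w] satisfies [t <= m * e * t = (1 - e) * t]. *)
move=> mn; pose e : R := m.+1%:R^-1.
have e0 : 0 < e by rewrite invr_gt0 ltr0n.
have e1 : e <= 1 by rewrite invf_le1 ?ler1n // ltr0n.
pose X0 : M := pid_mx m.
apply: (@lt_le_trans _ _ (mat_lebesgue (box X0 e))).
  by rewrite /mat_lebesgue /mat_int entries_int_box // lte_fin exprn_gt0 // mulr_gt0.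
apply: le_measure; rewrite ?inE; [exact: measurable_box|exact: measurable_frame_region|].
move=> X BX.
have XX0 i j : `|X i j - X0 i j| <= e.
  by have := BX i j; rewrite in_itv /= -ler_distl.
split.
  have X2 i j : X i j ^+ 2 <= 4.
    have X01 : 0 <= X0 i j <= 1 by rewrite /X0 mxE ler0n /= lern1 leq_b1.
    have := BX i j; rewrite in_itv /=; nra.
  rewrite tr_gram; apply: (@le_trans _ _ (\sum_(i < m) \sum_(j < n) 4)).
    by apply: ler_sum => i _; apply: ler_sum => j _; exact: X2.
  rewrite !sumr_const !card_ord -!mulrnA.
  by rewrite mulnA.
apply/gram_det_neq0 => w Xw.
pose wd (a : 'I_m) : 'I_n := widen_ord mn a.
pose t := \sum_a `|w a 0|.
have wa a : `|w a 0| <= e * t.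
  have : (X *m w) (wd a) 0 = 0 by rewrite Xw mxE.
  rewrite mxE => Sw.
  have -> : w a 0 = - \sum_b (X (wd a) b - X0 (wd a) b) * w b 0.
    under eq_bigr do rewrite mulrBl.
    rewrite sumrB Sw sub0r opprK (bigD1 a) //= big1 ?addr0 => [|b ba].
      by rewrite mxE /= eqxx ltn_ord mul1r.
    by rewrite mxE /= -(inj_eq val_inj) /= eq_sym in ba *; rewrite (negbTE ba) mul0r.
  rewrite normrN; apply: le_trans (ler_norm_sum _ _ _) _.
  by rewrite mulr_sumr; apply: ler_sum => b _; rewrite normrM ler_wpM2r.
have t_le : t <= m%:R * (e * t).
  apply: (@le_trans _ _ (\sum_(a < m) e * t)); first by apply: ler_sum => a _; exact: wa.
  by rewrite sumr_const card_ord mulr_natl.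
have me : m%:R * e = 1 - e.
  by rewrite /e -natr1; field; rewrite natr1 pnatr_eq0.
have t0 : t <= 0.
  move: t_le; rewrite mulrA me mulrBl mul1r -subr_ge0 addrAC subrr add0r oppr_ge0.
  by rewrite pmulr_rle0.
apply/matrixP => a b; rewrite ord1 mxE; apply/eqP; rewrite -normr_le0.
apply: le_trans t0; rewrite /t (bigD1 a) //= lerDl; exact: sumr_ge0.
Qed.

(* Lebesgue measure on a bounded O(n)-invariant set of injective matrices is pushed
   to the Stiefel manifold by Gram-Schmidt, which commutes with O(n). *)
Lemma haar_stiefel : (m <= n)%N ->
  exists mu : probability (matB R n m) R,
    mu [set X | (X : M)^T *m (X : M) = 1%:M] = 1%E /\
    forall g : 'M[R]_n, g^T *m g = 1%:M -> forall A : set (matB R n m), measurable A ->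
      mu ((fun X : matB R n m => (g *m (X : M) : matB R n m)) @^-1` A) = mu A.
Proof.
move=> mn; have mK := measurable_frame_region.
pose Phi (X : matB R n m) : matB R n m := gram_schmidt m (X : M).
have mPhi : measurable_fun setT Phi by exact: measurable_gram_schmidt.
have [nu nuE0] := ex_pushforward_measure (mrestr mat_lebesgue mK) mPhi.
have nuE A : nu A = mat_lebesgue (Phi @^-1` A `&` frame_region) by rewrite nuE0.
have nuT : nu setT = mat_lebesgue frame_region by rewrite nuE preimage_setT setTI.
have nuT0 : nu setT != 0%E by rewrite nuT gt_eqF // frame_region_gt0.
have nuTy : nu setT != +oo%E by rewrite nuT lt_eqF // frame_region_lty.
pose mu : probability (matB R n m) R := mnormalize nu (dirac ((0 : M) : matB R n m)).
have muE A : mu A = (nu A * (fine (nu setT))^-1%:E)%E.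
  by rewrite /mu /= /mnormalize (negbTE nuT0) (negbTE nuTy).
exists mu; split.
  rewrite muE.
  have -> : nu [set X | (X : M)^T *m (X : M) = 1%:M] = nu setT.
    rewrite nuT nuE; congr mat_lebesgue; apply/setIidPr => X [_ /gram_det_neq0 Xinj] /=.
    exact: (gram_schmidt_orthonormal Xinj).1.
  have nuf : nu setT \is a fin_num by rewrite ge0_fin_numE // ltey.
  by rewrite -{1}(fineK nuf) -EFinM divff // fine_eq0.
move=> g gg A mA; rewrite !muE; congr (_ * _)%E; rewrite !nuE.
have gu : g \in unitmx by have /mulmx1_unit[] := gg.
have KE (X : M) : frame_region (g *m X) = frame_region X.
  by rewrite /frame_region /= trmx_mul mulmxA -(mulmxA X^T) gg mulmx1.
have [c c0 cE] := mat_lebesgue_mul gu.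
(* The region is mapped to itself and has finite nonzero measure, so the factor of [g] is 1. *)
have c1 : c = 1.
  have := cE _ mK.
  have -> : [set X : matB R n m | frame_region (g *m (X : M))] = frame_region.
    by apply/seteqP; split => X /=; rewrite KE.
  rewrite -nuT; have nuf : nu setT \is a fin_num by rewrite ge0_fin_numE // ltey.
  rewrite -{1 2}(fineK nuf) -EFinM => -[].
  have f0 : fine (nu setT) != 0 by rewrite fine_eq0.
  by rewrite -{1}[fine (nu setT)]mul1r => /(mulIf f0) ->.
have mD : measurable (Phi @^-1` A `&` frame_region).
  by apply: measurableI => //; rewrite -[X in measurable X]setTI; exact: mPhi.
rewrite -[RHS]mul1e -c1 -cE //; congr mat_lebesgue.
apply/seteqP; split => X /=; rewrite KE /Phi gram_schmidt_equivariant //.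
Qed.

End Haar.

(** * Orthogonally invariant conditions on symmetric matrices, and designs *)

Section SymmetricMatrices.
Context {R : realType} {n : nat}.
Implicit Types (g M : 'M[R]_n) (u v w : 'cV[R]_n).

Definition dot u v : R := (u^T *m v) 0 0.

Lemma dotC u v : dot u v = dot v u.
Proof. by rewrite /dot -[in LHS](trmxK v) -trmx_mul mxE. Qed.

Lemma dotDl u v w : dot (u + v) w = dot u w + dot v w.
Proof. by rewrite /dot linearD /= mulmxDl mxE. Qed.

Lemma dotZl a u v : dot (a *: u) v = a * dot u v.
Proof. by rewrite /dot linearZ /= -scalemxAl mxE. Qed.

Lemma dotDr u v w : dot u (v + w) = dot u v + dot u w.
Proof. by rewrite /dot mulmxDr mxE. Qed.

Lemma dotZr a u v : dot u (a *: v) = a * dot u v.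
Proof. by rewrite /dot -scalemxAr mxE. Qed.

Lemma dotBl u v w : dot (u - v) w = dot u w - dot v w.
Proof. by rewrite -scaleN1r dotDl dotZl mulN1r. Qed.

Lemma dotBr u v w : dot u (v - w) = dot u v - dot u w.
Proof. by rewrite !(dotC u) dotBl. Qed.

Lemma dot_gt0 u : u != 0 -> 0 < dot u u.
Proof. exact: normsq_gt0. Qed.

Lemma dot_mulmx M u v : dot u (M *m v) = dot (M^T *m u) v.
Proof. by rewrite /dot trmx_mul trmxK mulmxA. Qed.

Lemma trace_rank1 M u v : \tr (M *m (u *m v^T)) = dot v (M *m u).
Proof.
rewrite mulmxA mxtrace_mulC /dot.
by rewrite /mxtrace big_ord1.
Qed.

Definition reflection w : 'M[R]_n := 1%:M - (2 / dot w w) *: (w *m w^T).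

Lemma reflectionT w : (reflection w)^T = reflection w.
Proof. by rewrite /reflection linearB /= linearZ /= trmx_mul trmxK trmx1. Qed.

Lemma reflection_mul w u : reflection w *m u = u - (2 * dot w u / dot w w) *: w.
Proof.
rewrite mulmxBl mul1mx -scalemxAl -mulmxA [w^T *m u]mx11_scalar mul_mx_scalar.
by rewrite scalerA -/(dot w u) mulrAC.
Qed.

Lemma reflection_orth w : w != 0 -> (reflection w)^T *m reflection w = 1%:M.
Proof.
move=> /dot_gt0 w0; rewrite reflectionT.
have d0 : dot w w != 0 by rewrite gt_eqF.
have PP : w *m w^T *m (w *m w^T) = dot w w *: (w *m w^T).
  by rewrite mulmxA -(mulmxA w) [w^T *m w]mx11_scalar mul_mx_scalar -scalemxAl.
rewrite /reflection mulmxBr mulmx1 mulmxBl mul1mx -scalemxAl -scalemxAr PP !scalerA.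
rewrite -scalerBl -addrA -opprD -scalerDl.
have -> : 2 / dot w w + (2 / dot w w - 2 / dot w w * (2 / dot w w) * dot w w) = 0 by field.
by rewrite scale0r subr0.
Qed.

Lemma reflection_swap u v : dot u u = dot v v -> u != v -> reflection (u - v) *m u = v.
Proof.
move=> uv nuv; rewrite reflection_mul.
have w0 : dot (u - v) (u - v) != 0 by rewrite gt_eqF // dot_gt0 // subr_eq0.
have -> : 2 * dot (u - v) u / dot (u - v) (u - v) = 1.
  apply: (canLR (mulfK w0)); rewrite mul1r.
  rewrite !(dotBl, dotBr) (dotC v u) -uv; ring.
by rewrite scale1r opprB addrC subrK.
Qed.

(** At most two reflections: one takes [u] to [a]; the next takes the image of [v] to [b] and fixes
    [a], which is orthogonal to both. *)
Lemma orth_pair u v a b :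
  dot u u = 1 -> dot v v = 1 -> dot u v = 0 ->
  dot a a = 1 -> dot b b = 1 -> dot a b = 0 ->
  exists2 g, g^T *m g = 1%:M & g *m u = a /\ g *m v = b.
Proof.
move=> uu vv uv aa bb ab.
have one x y : dot x x = 1 -> dot y y = 1 -> exists2 g, g^T *m g = 1%:M &
    g *m x = y /\ forall z, dot z x = 0 -> dot z y = 0 -> g *m z = z.
  move=> xx yy; have [->|xy] := eqVneq x y.
    exists 1%:M; rewrite ?trmx1 ?mulmx1 //; split; first by rewrite mul1mx.
    by move=> z; rewrite mul1mx.
  exists (reflection (x - y)); first by apply: reflection_orth; rewrite subr_eq0.
  split; first by rewrite reflection_swap // xx.
  move=> z zx zy; rewrite reflection_mul dotBl !(dotC _ z) zx zy.
  by rewrite subrr mulr0 mul0r scale0r subr0.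
have [g1 o1 [g1u _]] := one u a uu aa.
have g1dot x y : dot (g1 *m x) (g1 *m y) = dot x y.
  by rewrite /dot trmx_mul mulmxA -(mulmxA x^T) o1 mulmx1.
have [g2 o2 [g2v g2z]] : exists2 g, g^T *m g = 1%:M &
    g *m (g1 *m v) = b /\ forall z, dot z (g1 *m v) = 0 -> dot z b = 0 -> g *m z = z.
  by apply: one; rewrite ?g1dot.
exists (g2 *m g1).
  by rewrite trmx_mul mulmxA -(mulmxA g1^T) o2 mulmx1.
rewrite -!mulmxA g2v; split=> //; rewrite g1u g2z //.
by rewrite -g1u g1dot.
Qed.

Lemma dot_delta i j : dot (delta_mx i 0) (delta_mx j 0) = (i == j)%:R.
Proof.
rewrite /dot trmx_delta mxE (bigD1 i) //= big1 ?addr0; last first.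
  by move=> k ki; rewrite mxE (negbTE ki) andbF mul0r.
by rewrite !mxE !eqxx mul1r andbT.
Qed.

Lemma dot_delta_mulmx M i j : dot (delta_mx i 0) (M *m delta_mx j 0) = M i j.
Proof.
rewrite /dot trmx_delta mulmxA -rowE mxE (bigD1 j) //= big1 ?addr0.
  by rewrite !mxE !eqxx mulr1.
by move=> k kj; rewrite !mxE (negbTE kj) mulr0.
Qed.

(* If [Pi] has an eigenvector for a nonzero eigenvalue and a kernel vector, testing the
   hypothesis against the reflections along [u + v] and [u + 2 v] shows that [M] restricted
   to any orthonormal pair is scalar. *)
Lemma orbit_orthogonal_eq0 (Pi M : 'M[R]_n) u v (al : R) :
  Pi^T = Pi -> M^T = M -> dot u u = 1 -> dot v v = 1 -> dot u v = 0 ->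
  al != 0 -> Pi *m u = al *: u -> Pi *m v = 0 -> \tr Pi != 0 ->
  (forall g, g^T *m g = 1%:M -> \tr (Pi *m (g^T *m M *m g)) = 0) -> M = 0.
Proof.
move=> PiT MT uu vv uv al0 Piu Piv trPi H.
have key N w : N^T = N -> w != 0 -> \tr (Pi *m N) = 0 ->
    \tr (Pi *m ((reflection w)^T *m N *m reflection w)) = 0 ->
    dot w (Pi *m (N *m w)) * dot w w = dot w (Pi *m w) * dot w (N *m w).
  move=> NT w0 t0; have d0 : dot w w != 0 by rewrite gt_eqF // dot_gt0.
  rewrite reflectionT /reflection; set r := 2 / dot w w; set P := w *m w^T.
  have -> : (1%:M - r *: P) *m N *m (1%:M - r *: P) =
      N - r *: (P *m N) + (r * r) *: (P *m N *m P) - r *: (N *m P).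
    rewrite [(1%:M - _) *m N]mulmxBl mul1mx -scalemxAl.
    by rewrite mulmxBr mulmx1 -scalemxAr mulmxBl -scalemxAl scalerBr scalerA opprB addrA.
  rewrite mulmxBr mulmxDr mulmxBr -!scalemxAr.
  rewrite raddfB /= raddfD /= raddfB /= !mxtraceZ t0 sub0r.
  have -> : \tr (Pi *m (P *m N)) = dot w (Pi *m (N *m w)).
    have -> : \tr (Pi *m (P *m N)) = \tr (N *m Pi *m (w *m w^T)).
      by rewrite (mulmxA Pi P N) [LHS]mxtrace_mulC (mulmxA N Pi P).
    rewrite trace_rank1 -mulmxA [LHS]dot_mulmx NT dotC.
    by rewrite [RHS]dot_mulmx PiT.
  have -> : \tr (Pi *m (N *m P)) = dot w (Pi *m (N *m w)).
    by rewrite mulmxA /P trace_rank1 mulmxA.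
  have -> : \tr (Pi *m (P *m N *m P)) = dot w (N *m w) * dot w (Pi *m w).
    have -> : P *m N *m P = dot w (N *m w) *: P.
      rewrite /P mulmxA -(mulmxA w w^T N) -(mulmxA w) -(mulmxA w^T).
      by rewrite [w^T *m (N *m w)]mx11_scalar mul_mx_scalar -scalemxAl.
    by rewrite -scalemxAr mxtraceZ /P trace_rank1.
  move: (dot w (Pi *m (N *m w))) (dot w (N *m w)) (dot w (Pi *m w)) => x y z.
  have rd : r * dot w w = 2 by rewrite /r divfK.
  have r0 : r != 0 by rewrite /r mulf_neq0 ?invr_neq0.
  move=> E; apply: (mulfI r0); apply: (mulfI (x := 2)) => //.
  rewrite [LHS](_ : _ = 2 * x * (r * dot w w)); last by ring.
  rewrite rd.
  have : r * (r * y * z - 2 * x) = 0 by rewrite -E; ring.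
  move/eqP; rewrite mulf_eq0 (negbTE r0) subr_eq0 /= => /eqP E2.
  by rewrite -E2; ring.
have pair g : g^T *m g = 1%:M ->
    dot (g *m u) (M *m (g *m v)) = 0 /\
    dot (g *m u) (M *m (g *m u)) = dot (g *m v) (M *m (g *m v)).
  move=> gg; pose N := g^T *m M *m g.
  have NT : N^T = N by rewrite /N !trmx_mul trmxK MT mulmxA.
  have NE x y : dot (g *m x) (M *m (g *m y)) = dot x (N *m y).
    by rewrite /dot /N trmx_mul !mulmxA.
  rewrite !NE.
  have rel (t : R) : (dot u (N *m u) + t * dot u (N *m v)) * (1 + t ^+ 2) =
      dot u (N *m u) + 2 * t * dot u (N *m v) + t ^+ 2 * dot v (N *m v).
    pose w := u + t *: v.
    have ww : dot w w = 1 + t ^+ 2.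
      by rewrite /w !(dotDl, dotDr, dotZl, dotZr) uu vv uv dotC uv; ring.
    have w0 : w != 0.
      apply/eqP => w0; move: ww; rewrite w0 /dot mulmx0 mxE => /esym/eqP.
      by rewrite gt_eqF // ltr_wpDr ?sqr_ge0.
    have Piw : Pi *m w = al *: u by rewrite /w mulmxDr Piu -scalemxAr Piv scaler0 addr0.
    have gr : (g *m reflection w)^T *m (g *m reflection w) = 1%:M.
      by rewrite trmx_mul mulmxA -(mulmxA _ g^T) gg mulmx1 reflection_orth.
    have k1 : \tr (Pi *m N) = 0 by exact: H.
    have k2 : \tr (Pi *m ((reflection w)^T *m N *m reflection w)) = 0.
      by rewrite -(H _ gr) /N trmx_mul !mulmxA.
    have := key N w NT w0 k1 k2; rewrite ww.
    have wPi x : dot w (Pi *m x) = al * dot u x by rewrite dot_mulmx PiT Piw dotZl.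
    have uw : dot u w = 1 by rewrite /w dotDr dotZr uu uv mulr0 addr0.
    have vu : dot v (N *m u) = dot u (N *m v) by rewrite dot_mulmx NT dotC.
    have Nw : N *m w = N *m u + t *: (N *m v) by rewrite /w mulmxDr -scalemxAr.
    rewrite !wPi uw Nw mulr1 /w !(dotDl, dotDr, dotZl, dotZr) vu => E.
    apply: (mulfI al0); rewrite mulrA E; ring.
  (* [t = 1] gives [x = z], after which [t = 2] gives [y = 0]. *)
  have := rel 1; have := rel 2; move: (dot u _) (dot u _) (dot v _) => x y z; split; lra.
have pairs a b : dot a a = 1 -> dot b b = 1 -> dot a b = 0 ->
    dot a (M *m b) = 0 /\ dot a (M *m a) = dot b (M *m b).
  by move=> aa bb ab; have [g gg [<- <-]] := orth_pair uu vv uv aa bb ab; exact: pair.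
have [[i0 _]|n0] := pselect (exists i : 'I_n, true); last first.
  by apply/matrixP => i; case: n0; exists i.
have ME : M = (M i0 i0)%:M.
  apply/matrixP => i j; rewrite mxE; have [->|ij] := eqVneq i j; last first.
    have [] := pairs (delta_mx i 0) (delta_mx j 0); rewrite ?dot_delta ?eqxx ?(negbTE ij) //.
    by rewrite dot_delta_mulmx.
  rewrite mulr1n; have [->//|ij] := eqVneq j i0.
  have [] := pairs (delta_mx j 0) (delta_mx i0 0); rewrite ?dot_delta ?eqxx ?(negbTE ij) //.
  by rewrite !dot_delta_mulmx.
(* [M] is scalar by now, and the nonzero trace of [Pi] kills the scalar. *)
have := H 1%:M; rewrite trmx1 !mulmx1 mul1mx => /(_ erefl).
rewrite {1}ME mul_mx_scalar linearZ /= => /eqP; rewrite mulf_eq0 (negbTE trPi) orbF => /eqP M0.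
by rewrite ME M0 raddf0.
Qed.

(** Commuting with a reflection means commuting with [w *m w^T], so every nonzero [w] is an
    eigenvector; comparing [e_i], [e_j] and [e_i + e_j] leaves a single eigenvalue. *)
Lemma orth_invariant_scalar (S : 'M[R]_n) :
  (forall g, g^T *m g = 1%:M -> g *m S = S *m g) -> exists s, S = s%:M.
Proof.
move=> H.
have com w : w != 0 -> w *m w^T *m S = S *m (w *m w^T).
  move=> w0; have := H _ (reflection_orth w0); rewrite /reflection mulmxBl mulmxBr mul1mx mulmx1.
  move/addrI/oppr_inj; rewrite -scalemxAl -scalemxAr.
  by apply: scalerI; rewrite mulf_neq0 // invr_neq0 // gt_eqF // dot_gt0.
have comv w x : w != 0 -> dot w (S *m x) *: w = dot w x *: (S *m w).
  move=> /com /(congr1 (mulmx^~ x)) /=; rewrite -!mulmxA.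
  by rewrite [w^T *m (S *m x)]mx11_scalar [w^T *m x]mx11_scalar !mul_mx_scalar -scalemxAr.
have dn0 (i : 'I_n) : delta_mx i (0 : 'I_1) != 0 :> 'cV[R]_n.
  by apply/eqP => /matrixP/(_ i 0)/eqP; rewrite !mxE !eqxx oner_eq0.
have off i j : i != j -> S i j = 0.
  move=> ij; have := comv _ (delta_mx j 0) (dn0 i).
  rewrite dot_delta_mulmx dot_delta (negbTE ij) scale0r => /matrixP/(_ i 0).
  by rewrite !mxE !eqxx mulr1.
have diag i j : i != j -> S i i = S j j.
  move=> ij; pose w : 'cV[R]_n := delta_mx i 0 + delta_mx j 0.
  have w0 : w != 0.
    apply/eqP => /matrixP/(_ i 0)/eqP; rewrite !mxE !eqxx (negbTE ij) addr0.
    by rewrite oner_eq0.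
  have := comv _ (delta_mx j 0) w0.
  rewrite /w !dotDl !dot_delta_mulmx !dot_delta eqxx (negbTE ij) add0r scale1r off // add0r.
  move=> /(congr1 (dot (delta_mx i 0))).
  rewrite mulmxDr dotZr !dotDr !dot_delta_mulmx !dot_delta eqxx (negbTE ij) (off i j) // !addr0.
  by rewrite mulr1.
have [i0|n0] := pselect (exists i : 'I_n, true); last first.
  exists 0; apply/matrixP => i; by case: n0; exists i.
case: i0 => i0 _; exists (S i0 i0); apply/matrixP => i j; rewrite mxE.
have [->|ij] := eqVneq i j; last by rewrite off.
by rewrite mulr1n; have [->//|ji] := eqVneq j i0; exact: diag.
Qed.

End SymmetricMatrices.

(** * Polynomial functions of frames and averages over a design *)

Section Polynomials.
Context {R : realType} {n : nat} {lamc : seq nat}.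
Local Notation m := (mdim lamc).
Local Notation M := 'M[R]_(n, m).
Local Notation poly_fun := (@poly_fun R n lamc).

Lemma poly_fun_fin (d : nat) (I : finType) (c : I -> R) (e : I -> 'I_n -> 'I_m -> nat) :
  (forall l, (\sum_i \sum_j e l i j <= d)%N) ->
  poly_fun d (fun X => \sum_l c l * \prod_i \prod_j X i j ^+ e l i j).
Proof.
move=> ed; exists #|I|, (fun l => c (enum_val l)), (fun l => e (enum_val l)).
split=> [l|X]; first exact: ed.
rewrite (reindex (enum_val : 'I_#|I| -> I)) //=.
exact: onW_bij (enum_val_bij I).
Qed.

Lemma poly_fun_cst d (a : R) : poly_fun d (fun=> a).
Proof.
exists 1%N, (fun=> a), (fun _ _ _ => 0%N); split=> [l|X].
  by rewrite big1 // => i _; rewrite big1.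
by rewrite big_ord1 big1 ?mulr1 // => i _; rewrite big1.
Qed.

Lemma poly_fun_coord i j : poly_fun 1 (fun X => X i j).
Proof.
exists 1%N, (fun=> 1), (fun _ i' j' => (i' == i) && (j' == j) : nat); split=> [l|X].
  rewrite (bigD1 i) //= (bigD1 j) //= !eqxx big1 ?big1 //= => [i' /negbTE i'i|j' /negbTE ->] //.
  by rewrite big1 // => j' _; rewrite i'i.
rewrite big_ord1 mul1r (bigD1 i) //= (bigD1 j) //= !eqxx expr1.
rewrite big1 => [|j' /negbTE ->]; last by rewrite expr0.
rewrite big1 ?mulr1 // => i' /negbTE i'i; rewrite big1 // => j' _.
by rewrite i'i expr0.
Qed.

Lemma poly_fun_le d d' P : (d <= d')%N -> poly_fun d P -> poly_fun d' P.
Proof.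
move=> dd [k [c [e [ed PE]]]]; exists k, c, e; split=> // l; exact: leq_trans (ed l) dd.
Qed.

Lemma poly_funD d P Q : poly_fun d P -> poly_fun d Q -> poly_fun d (fun X => P X + Q X).
Proof.
move=> [k [c [e [ed PE]]]] [k' [c' [e' [ed' QE]]]].
have := @poly_fun_fin d ('I_k + 'I_k')%type
  (fun l => match l with inl a => c a | inr b => c' b end)
  (fun l => match l with inl a => e a | inr b => e' b end).
case=> [[l|l]|k2 [c2 [e2 [ed2 E]]]]; [exact: ed|exact: ed'|].
exists k2, c2, e2; split=> // X; rewrite -E big_sumType /= PE QE.
by [].
Qed.

Lemma poly_funM d d' P Q :
  poly_fun d P -> poly_fun d' Q -> poly_fun (d + d') (fun X => P X * Q X).
Proof.
move=> [k [c [e [ed PE]]]] [k' [c' [e' [ed' QE]]]].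
have := @poly_fun_fin (d + d') ('I_k * 'I_k')%type
  (fun l => c l.1 * c' l.2) (fun l i j => (e l.1 i j + e' l.2 i j)%N).
case=> [l|k2 [c2 [e2 [ed2 E]]]].
  under eq_bigr do rewrite big_split; rewrite big_split /=; exact: leq_add.
exists k2, c2, e2; split=> // X; rewrite -E PE QE big_distrlr /= pair_bigA /=.
apply: eq_bigr => l _; rewrite mulrACA -big_split /=; congr (_ * _).
by apply: eq_bigr => i _; rewrite -big_split /=; apply: eq_bigr => j _; rewrite exprD.
Qed.

Lemma poly_fun_sum d (I : Type) (r : seq I) (F : I -> M -> R) :
  (forall i, poly_fun d (F i)) -> poly_fun d (fun X => \sum_(i <- r) F i X).
Proof.
move=> dF; elim: r => [|i r IH].
  by under eq_fun do rewrite big_nil; exact: poly_fun_cst.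
by under eq_fun do rewrite big_cons; exact: poly_funD.
Qed.

Lemma measurable_poly_fun d P : poly_fun d P ->
  measurable_fun setT (fun X : mxBorel R n lamc => P (X : M)).
Proof.
move=> [k [c [e [_ PE]]]]; under eq_fun do rewrite PE.
apply: measurable_sum => l; apply: measurable_funM => //.
apply: measurable_prod => i _; apply: measurable_prod => j _.
by apply: measurable_funX; exact: measurable_entry.
Qed.

Definition flag_diag (k : nat) : 'M[R]_m := \matrix_(a, b) ((a == b) && (a < k)%N)%:R.

Definition flag_weight : 'M[R]_m := \sum_(i < size lamc) flag_diag (part i).

(** For orthonormal [X] this is the sum of the projections onto the spaces of the flag. The formula
    makes sense for every matrix and is quadratic, which makes its traces admissible test
    functions. *)
Definition flag_form (X : M) : 'M[R]_n := X *m flag_weight *m X^T.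

Lemma flag_diagT k : (flag_diag k)^T = flag_diag k.
Proof.
by apply/matrixP => a b; rewrite !mxE eq_sym; case: eqP => [->|].
Qed.

Lemma flag_weightT : flag_weight^T = flag_weight.
Proof. by rewrite /flag_weight raddf_sum; apply: eq_bigr => i _; exact: flag_diagT. Qed.

Lemma flag_formT X : (flag_form X)^T = flag_form X.
Proof. by rewrite /flag_form !trmx_mul trmxK flag_weightT mulmxA. Qed.

(** [flag_weight] is diagonal and constant on each block, so it commutes with the block group. *)
Lemma flag_form_block h X : block_group h -> flag_form (X *m h) = flag_form X.
Proof.
move=> [hh hb].
have comm : h *m flag_weight = flag_weight *m h.
  rewrite /flag_weight mulmx_sumr mulmx_suml; apply: eq_bigr => i _.
  apply/matrixP => a b; rewrite !mxE (bigD1 b) //= [RHS](bigD1 a) //=.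
  rewrite big1 => [|c cb]; last by rewrite mxE (negbTE cb) mulr0.
  rewrite [\sum_(c | c != a) _]big1 // => [|c ca]; last by rewrite mxE eq_sym (negbTE ca) mul0r.
  rewrite !mxE !eqxx !addr0 /= mulrC.
  have [sb|/hb ->] := pselect (same_block a b); last by rewrite !mulr0.
  by rewrite sb // /part mem_nth.
have hhT : h *m h^T = 1%:M by exact: mulmx1C.
rewrite /flag_form trmx_mul -!mulmxA (mulmxA h) comm -(mulmxA flag_weight).
by rewrite (mulmxA h) hhT mul1mx.
Qed.

Lemma poly_fun_trace A : poly_fun 2 (fun X => \tr (flag_form X *m A)).
Proof.
have -> : (fun X : M => \tr (flag_form X *m A)) = fun X : M => \sum_a \sum_b \sum_c \sum_d
    X a d * X b c * (flag_weight d c * A b a).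
  apply/funext => X; apply: eq_bigr => a _; rewrite mxE; apply: eq_bigr => b _.
  rewrite mxE mulr_suml; apply: eq_bigr => c _; rewrite !mxE !mulr_suml.
  apply: eq_bigr => d _; ring.
do 4! [apply: poly_fun_sum => ?].
apply: (@poly_funM 2 0); last exact: poly_fun_cst.
by apply: (@poly_funM 1 1); exact: poly_fun_coord.
Qed.

Lemma ex_stiefel_invariant : (m <= n)%N ->
  exists mu : probability (mxBorel R n lamc) R, stiefel_invariant mu.
Proof. by move=> /haar_stiefel -/(_ R) [mu [mu1 mug]]; exists mu; split. Qed.

Lemma stiefel_integral_mul (mu : probability (mxBorel R n lamc) R) (g : 'M[R]_n)
    (f : mxBorel R n lamc -> \bar R) :
  stiefel_invariant mu -> g^T *m g = 1%:M -> measurable_fun setT f ->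
  (\int[mu]_X f (g *m (X : M) : mxBorel R n lamc) = \int[mu]_X f X)%E.
Proof.
move=> [_ inv] gg mf.
pose L (X : mxBorel R n lamc) : mxBorel R n lamc := g *m (X : M).
have mL : measurable_fun setT L.
  exact: (measurable_mulmx (F := cst (g : matB R n n)) (G := fun X : matB R n m => X)).
have nonneg (h : mxBorel R n lamc -> \bar R) : measurable_fun setT h ->
    (forall X, 0 <= h X)%E -> (\int[mu]_X h (L X) = \int[mu]_X h X)%E.
  move=> mh h0; have H := ge0_integral_pushforward mL mu measurableT mh (fun y _ => h0 y).
  apply/esym/(etrans _ H); apply: eq_measure_integral => A mA _.
  exact: (esym (inv g gg A mA)).
rewrite -[LHS]/(\int[mu]_X (f \o L) X)%E integralE [RHS]integralE.
congr (_ - _)%E.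
  transitivity (\int[mu]_X f^\+ (L X))%E; first by apply: eq_integral => X _; rewrite !funeposE.
  apply: nonneg; [exact: measurable_funepos|by move=> X; exact: funepos_ge0].
transitivity (\int[mu]_X f^\- (L X))%E; first by apply: eq_integral => X _; rewrite !funenegE.
apply: nonneg; [exact: measurable_funeneg|by move=> X; exact: funeneg_ge0].
Qed.

Section Design.
Variables (k : nat) (Xs : 'I_k -> M).
Hypothesis design : forall mu : probability (mxBorel R n lamc) R, stiefel_invariant mu ->
  forall P : M -> R, poly_fun 4 P -> block_invariant P ->
  (\int[mu]_X (P X)%:E)%E = ((k%:R)^-1 * \sum_j P (Xs j))%:E.
Hypothesis mn : (m <= n)%N.

(** Tested on the constant 1: an empty design would give 0, the inverse of 0 being 0, whereas the
    integral is 1. *)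
Lemma design_nonempty : (0 < k)%N.
Proof.
have [mu inv] := ex_stiefel_invariant mn.
have := design inv (poly_fun_cst 4 1) (fun _ _ _ => erefl).
have -> : (\int[mu]_X (1 : R)%:E)%E = 1%:E.
  by rewrite integral_cst // mul1e; exact: probability_setT.
case.
by case: (k) => // /eqP; rewrite invr0 mul0r oner_eq0.
Qed.

Lemma design_mul P (g : 'M[R]_n) : g^T *m g = 1%:M ->
  poly_fun 4 P -> block_invariant P ->
  poly_fun 4 (fun X => P (g *m X)) -> block_invariant (fun X => P (g *m X)) ->
  \sum_j P (g *m Xs j) = \sum_j P (Xs j).
Proof.
move=> gg pP bP pPg bPg; have [mu inv] := ex_stiefel_invariant mn.
have k0 : (k%:R : R) != 0 by rewrite pnatr_eq0 -lt0n design_nonempty.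
have E1 := design inv pP bP; have E2 := design inv pPg bPg.
have mP : measurable_fun setT (fun X : mxBorel R n lamc => (P (X : M))%:E).
  by apply/measurable_EFinP; exact: measurable_poly_fun pP.
have := stiefel_integral_mul inv gg mP.
rewrite E1 E2 => -[]; apply: mulfI; exact: invr_neq0.
Qed.

Lemma flag_form_mul (g : 'M[R]_n) X A :
  \tr (flag_form (g *m X) *m A) = \tr (flag_form X *m (g^T *m A *m g)).
Proof.
rewrite /flag_form trmx_mul -!mulmxA mxtrace_mulC -!mulmxA.
by [].
Qed.

Lemma design_trace A (g : 'M[R]_n) : g^T *m g = 1%:M ->
  \sum_j \tr (flag_form (Xs j) *m (g^T *m A *m g)) = \sum_j \tr (flag_form (Xs j) *m A).
Proof.
move=> gg; under eq_bigr do rewrite -flag_form_mul.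
apply: (design_mul (P := fun X => \tr (flag_form X *m A)) gg).
- exact: poly_fun_le (poly_fun_trace A).
- by move=> h X bh; rewrite flag_form_block.
- by under eq_fun do rewrite flag_form_mul; exact: poly_fun_le (poly_fun_trace _).
- by move=> h X bh; rewrite mulmxA flag_form_block.
Qed.

Lemma design_trace_sq A (g : 'M[R]_n) : g^T *m g = 1%:M ->
  \sum_j \tr (flag_form (Xs j) *m (g^T *m A *m g)) ^+ 2 =
  \sum_j \tr (flag_form (Xs j) *m A) ^+ 2.
Proof.
have poly2 B : poly_fun 4 (fun X => \tr (flag_form X *m B) ^+ 2).
  by under eq_fun do rewrite expr2; apply: (@poly_funM 2 2); exact: poly_fun_trace.
move=> gg; under eq_bigr do rewrite -flag_form_mul.
apply: (design_mul (P := fun X => \tr (flag_form X *m A) ^+ 2) gg) => //.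
- by move=> h X bh; rewrite flag_form_block.
- by under eq_fun do rewrite flag_form_mul; exact: poly2.
- by move=> h X bh; rewrite mulmxA flag_form_block.
Qed.

Hypothesis orthX : forall j, orthonormal_cols (Xs j).
Hypothesis lam0 : (0 < size lamc)%N.
Hypothesis lam_lt : all (fun p => (0 < p < n)%N) lamc.

Lemma flag_weight_ge0 a b : 0 <= flag_weight a b.
Proof. by rewrite summxE; apply: sumr_ge0 => i _; rewrite mxE. Qed.

Lemma trace_flag_form j : \tr (flag_form (Xs j)) = \tr flag_weight.
Proof. by rewrite /flag_form mxtrace_mulC mulmxA orthX mul1mx. Qed.

Lemma mdim_bounds : (0 < m < n)%N.
Proof. by have /allP/(_ m) := lam_lt; apply; rewrite /mdim mem_nth. Qed.

Lemma flag_weight0 (m0 : (0 < m)%N) : flag_weight (Ordinal m0) (Ordinal m0) = (size lamc)%:R.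
Proof.
rewrite summxE (eq_bigr (fun=> 1)) ?sumr_const ?card_ord // => i _.
rewrite mxE eqxx /=; have /allP/(_ (part i)) := lam_lt.
by rewrite /part mem_nth // => /(_ isT)/andP[-> _].
Qed.

Lemma trace_flag_weight_gt0 : 0 < \tr flag_weight.
Proof.
have /andP[m0 _] := mdim_bounds.
rewrite /mxtrace (bigD1 (Ordinal m0)) //= flag_weight0 ltr_wpDr ?ltr0n //.
by apply: sumr_ge0 => a _; exact: flag_weight_ge0.
Qed.

Lemma design_sum_scalar : exists2 s : R, 0 < s & \sum_j flag_form (Xs j) = s%:M.
Proof.
set S := \sum_j _.
have [g gg|s SE] := @orth_invariant_scalar R n S.
  have ggT : g *m g^T = 1%:M by exact: mulmx1C.
  have E : g *m S *m g^T = S.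
    apply/matrixP => a b.
    have := design_trace (delta_mx b a) gg.
    rewrite -!raddf_sum /= -!mulmx_suml -/S.
    rewrite mulmxA mxtrace_mulC !mulmxA.
    have tr A : \tr (A *m delta_mx b a) = A a b.
      rewrite /mxtrace (bigD1 a) //= big1 ?addr0 => [|c ca].
        rewrite mxE (bigD1 b) //= big1 ?addr0; first by rewrite mxE !eqxx mulr1.
        by move=> c cb; rewrite mxE (negbTE cb) mulr0.
      rewrite mxE big1 // => e _; by rewrite mxE (negbTE ca) andbF mulr0.
    by rewrite !tr.
  by rewrite -{2}E -!mulmxA gg mulmx1.
(* The sign of [s] is that of the trace, and every [flag_form (Xs j)] has the same positive
   trace. *)
exists s => //; have trS : \tr S = k%:R * \tr flag_weight.
  rewrite raddf_sum /=; under eq_bigr do rewrite trace_flag_form.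
  by rewrite sumr_const card_ord mulr_natl.
have : 0 < \tr S by rewrite trS mulr_gt0 ?trace_flag_weight_gt0 // ltr0n design_nonempty.
rewrite SE mxtrace_scalar => H; rewrite ltNge; apply/negP => s0.
by move: H; rewrite ltNge mulrn_wle0.
Qed.

Lemma design_orthogonal_eq0 A : A^T = A ->
  (forall j, \tr (flag_form (Xs j) *m A) = 0) -> A = 0.
Proof.
move=> AT A0; pose j0 := Ordinal design_nonempty.
have /andP[m0 mltn] := mdim_bounds.
(* The first column lies in every space of the flag, because all parts are positive, so its
   eigenvalue is the number [size lamc] of projections; a kernel vector exists because [m < n]. *)
pose u := col (Ordinal m0) (Xs j0).
have Xu : (Xs j0)^T *m u = delta_mx (Ordinal m0) 0 by rewrite /u colE mulmxA orthX mul1mx.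
have [v v0 vX] : exists2 v : 'cV[R]_n, v != 0 & (Xs j0)^T *m v = 0.
  have : kermx (Xs j0) != 0.
    rewrite kermx_eq0 /row_free; apply: contraTneq mltn => <-.
    by rewrite -leqNgt rank_leq_col.
  case/rowV0Pn => v /sub_kermxP vX v0; exists v^T; first by rewrite trmx_eq0.
  by rewrite -trmx_mul vX trmx0.
pose v1 := (Num.sqrt (dot v v))^-1 *: v.
have vv := dot_gt0 v0.
apply: (@orbit_orthogonal_eq0 R n (flag_form (Xs j0)) A u v1 (size lamc)%:R) => //.
- exact: flag_formT.
- rewrite /dot /u colE trmx_mul mulmxA -(mulmxA _ _ (Xs j0)) orthX mulmx1 trmx_delta.
  by rewrite mul_delta_mx mxE !eqxx.
- rewrite /v1 dotZl dotZr mulrA -expr2 exprVn sqr_sqrtr ?ltW // mulVf // gt_eqF //.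
- have uv : dot u v = 0 by rewrite /dot /u colE trmx_mul -mulmxA vX mulmx0 mxE.
  by rewrite /v1 dotZr uv mulr0.
- by rewrite pnatr_eq0 -lt0n.
- rewrite /flag_form -mulmxA Xu /u colE -mulmxA scalemxAr; congr (_ *m _).
  apply/matrixP => a b; rewrite !mxE (bigD1 (Ordinal m0)) //= big1 ?addr0 => [|c c0]; last first.
    by rewrite mxE (negbTE c0) mulr0.
  rewrite !mxE ord1 !eqxx mulr1.
  have [->|a0] := eqVneq a (Ordinal m0); first by rewrite flag_weight0 mulr1.
  by rewrite mulr0 summxE big1 // => i _; rewrite mxE (negbTE a0).
- by rewrite /flag_form /v1 -scalemxAr -!mulmxA vX !mulmx0 scaler0.
- by rewrite trace_flag_form gt_eqF // trace_flag_weight_gt0.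
(* The sum of squares is constant along the orbit of [A] and vanishes at [A], hence each square
   vanishes. *)
move=> g gg; have := design_trace_sq A gg.
rewrite [RHS]big1 => [/eqP|j _]; last by rewrite A0 expr0n.
rewrite psumr_eq0 => [/allP/(_ j0)|j _]; last exact: sqr_ge0.
by rewrite mem_index_enum sqrf_eq0 => /(_ isT)/eqP.
Qed.

(** Duality: outside the span, some linear form [y] would vanish on all [flag_form (Xs j)] but not
    on [A]. Symmetrising its matrix [Y] gives a symmetric matrix orthogonal to the design, hence 0,
    and a symmetric [A] pairs equally with [Y] and [Y^T]. *)
Lemma design_span A : A^T = A -> exists a : 'I_k -> R, A = \sum_j a j *: flag_form (Xs j).
Proof.
move=> AT.
pose G : 'M[R]_(k, n * n) := \matrix_j mxvec (flag_form (Xs j)).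
have [/submxP[w wE]|nsub] := boolP (mxvec A <= G)%MS.
  exists (fun j => w 0 j); apply: (can_inj mxvecK); rewrite wE mulmx_sum_row linear_sum /=.
  by apply: eq_bigr => j _; rewrite linearZ /= rowK.
have [y yG yA] : exists2 y : 'cV[R]_(n * n), G *m y = 0 & mxvec A *m y != 0.
  have : mxvec A *m cokermx G != 0 by rewrite -submxE.
  move=> /eqP nz; have [c cnz] : exists c, col c (mxvec A *m cokermx G) != 0.
    apply: contrapT => H; apply: nz; apply/matrixP => a c; rewrite mxE.
    have : col c (mxvec A *m cokermx G) = 0 by apply/eqP/negPn/negP => ?; apply: H; exists c.
    by move/matrixP/(_ a 0); rewrite !mxE.
  exists (col c (cokermx G)).
    by rewrite colE mulmxA mulmx_coker mul0mx.
  by rewrite colE mulmxA -colE.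
case/eqP: yA.
pose Y : 'M[R]_n := vec_mx y^T.
have vecE (B : 'M[R]_n) : (mxvec B *m y) 0 0 = \tr (B *m Y^T).
  rewrite mxE (reindex _ (curry_mxvec_bij _ _)) /mxtrace.
  under [RHS]eq_bigr do rewrite mxE.
  rewrite pair_bigA; apply: eq_bigr => -[i j] _ /=.
  by rewrite mxvecE !mxE.
have tr0 j : \tr (flag_form (Xs j) *m Y^T) = 0.
  rewrite -vecE; have := congr1 (row j) yG; rewrite row_mul rowK => ->.
  by rewrite !mxE.
have trT (B C : 'M[R]_n) : B^T = B -> \tr (B *m C^T) = \tr (B *m C).
  by move=> BT; rewrite -mxtrace_tr trmx_mul trmxK BT mxtrace_mulC.
have Y0 : Y + Y^T = 0.
  apply: design_orthogonal_eq0; first by rewrite linearD /= trmxK addrC.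
  by move=> j; rewrite mulmxDr raddfD /= tr0 -trT ?flag_formT // tr0 addr0.
apply/matrixP => a b; rewrite !ord1 vecE mxE.
have : \tr (A *m (Y + Y^T)) = 0 by rewrite Y0 mulmx0 raddf0.
rewrite mulmxDr raddfD /= -(trT A Y) // -mulr2n -mulr_natl => /eqP.
by rewrite mulf_eq0 pnatr_eq0 /= => /eqP.
Qed.

End Design.
End Polynomials.

(** * Chains of lattices and Voronoi's argument *)

Section GramMatrices.
Context {R : realType}.

Lemma gram_det_mull k n (K : 'M[R]_k) (C : 'M[R]_(k, n)) :
  gram_det (K *m C) = \det K ^+ 2 * gram_det C.
Proof.
by rewrite /gram_det trmx_mul !mulmxA !det_mulmx det_tr -mulmxA det_mulmx expr2; ring.
Qed.

(** The exponential form of [log det P <= tr P - k] for [P = Z *m Z^T], reached without eigenvalues: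
    removing from the other rows their component along the first row [z] keeps the determinant and
    does not increase the trace, and [a <= expR (a - 1)] accounts for [z] itself. *)
Lemma gram_det_le_expR k p (Z : 'M[R]_(k, p)) :
  0 <= gram_det Z <= expR (\tr (Z *m Z^T) - k%:R).
Proof.
elim: k Z => [|k IH] Z.
  by rewrite /gram_det det_mx00 /mxtrace big_ord0 subr0 expR0 ler01 lexx.
have [z [Y ->]] : exists z : 'rV[R]_p, exists Y : 'M[R]_(k, p), Z = col_mx z Y :> 'M[R]_(1 + k, p).
  by exists (usubmx (Z : 'M[R]_(1 + k, p))), (dsubmx (Z : 'M[R]_(1 + k, p))); rewrite vsubmxK.
pose a := (z *m z^T) 0 0.
have a0 : 0 <= a by rewrite /a mxE; apply: sumr_ge0 => i _; rewrite mxE -expr2 sqr_ge0.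
pose w : 'cV[R]_k := a^-1 *: (Y *m z^T).
pose Y' := Y - w *m z.
have zz : z *m z^T = a%:M by rewrite [LHS]mx11_scalar.
have zY' : Y' *m z^T = 0.
  rewrite /Y' mulmxBl -mulmxA zz mul_mx_scalar /w scalerA.
  have [a00|an0] := eqVneq a 0; last by rewrite divff // scale1r subrr.
  have -> : z = 0.
    apply/eqP/negPn/negP => zn; have : z^T != 0 by rewrite trmx_eq0.
    by move=> /normsq_gt0; rewrite trmxK -/a a00 ltxx.
  by rewrite trmx0 mulmx0 !scaler0 subrr.
pose L : 'M[R]_(1 + k) := block_mx 1%:M 0 (- w) 1%:M.
have dL : \det L = 1 by rewrite det_lblock !det1 mulr1.
have LZ : L *m col_mx z Y = col_mx z Y'.
  by rewrite mul_block_col mul0mx !mul1mx addr0 mulNmx addrC.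
have dE : gram_det (col_mx z Y) = a * gram_det Y'.
  rewrite -[LHS]mul1r -(expr1n R 2) -dL -gram_det_mull LZ /gram_det tr_col_mx mul_col_row zY'.
  have -> : z *m Y'^T = 0 by rewrite -[LHS]trmxK trmx_mul trmxK zY' trmx0.
  by rewrite zz det_ublock det_scalar1.
have trE : \tr (col_mx z Y *m (col_mx z Y)^T) = a + \tr (Y *m Y^T).
  by rewrite tr_col_mx mul_col_row mxtrace_block zz mxtrace_scalar.
have trY' : \tr (Y' *m Y'^T) <= \tr (Y *m Y^T).
  have -> : Y' *m Y'^T = Y *m Y^T - a *: (w *m w^T).
    rewrite {2}/Y' linearB /= mulmxBr trmx_mul (mulmxA Y') zY' mul0mx subr0 /Y' mulmxBl.
    congr (_ - _); rewrite -mulmxA.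
    have [a00|an0] := eqVneq a 0.
      rewrite a00 scale0r /w a00 invr0 scale0r mul0mx //.
    rewrite [RHS]scalemxAr; congr (_ *m _).
    by rewrite /w linearZ /= scalerA divff // scale1r trmx_mul trmxK.
  rewrite raddfB /= mxtraceZ gerBl mulr_ge0 // mxtrace_mulC.
  rewrite /mxtrace big_ord1; case: (eqVneq w 0) => [->|/normsq_gt0/ltW //].
  by rewrite mulmx0 mxE.
have /andP[g0 gle] := IH Y'.
rewrite dE mulr_ge0 //=.
have aexp : a <= expR (a - 1) by have := expR_ge1Dx (a - 1); rewrite addrC subrK.
apply: le_trans (ler_pM a0 g0 aexp gle) _.
rewrite -expRD ler_expR trE -natr1; lra.
Qed.

Lemma gram_det_ge0 k p (Z : 'M[R]_(k, p)) : 0 <= gram_det Z.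
Proof. by have /andP[] := gram_det_le_expR Z. Qed.

Lemma row_free_inj k n (C : 'M[R]_(k, n)) : row_free C ->
  forall w : 'cV[R]_k, C^T *m w = 0 -> w = 0.
Proof.
move=> fC w Cw; apply: trmx_inj; rewrite trmx0; apply: (row_free_inj fC).
by rewrite mul0mx -[LHS]trmxK trmx_mul trmxK Cw trmx0.
Qed.

Lemma gram_det_gt0 k n (C : 'M[R]_(k, n)) : row_free C -> 0 < gram_det C.
Proof.
move=> fC; rewrite lt_neqAle gram_det_ge0 andbT eq_sym /gram_det.
by have /gram_det_neq0 := row_free_inj fC; rewrite trmxK.
Qed.

Lemma gram_unitmx k n (C : 'M[R]_(k, n)) : row_free C -> C *m C^T \in unitmx.
Proof. by move=> /gram_det_gt0 g0; rewrite unitmxE unitfE gt_eqF. Qed.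

Lemma trace_proj_rows k n (C : 'M[R]_(k, n)) : row_free C -> \tr (proj_rows C) = k%:R.
Proof.
move=> /gram_unitmx uG; rewrite /proj_rows mxtrace_mulC mulmxA mulmxV // mxtrace1.
by [].
Qed.

(** The rows of [C] are orthonormalised by a square matrix [W^T]. This multiplies both Gram
    determinants by [\det W ^+ 2], and for orthonormal rows the trace of the Gram matrix of [Z] is
    the trace against the projection. *)
Lemma gram_det_mul_le k n (C : 'M[R]_(k, n)) (T : 'M[R]_n) : row_free C ->
  gram_det (C *m T) <= gram_det C * expR (\tr (proj_rows C *m (T *m T^T)) - k%:R).
Proof.
move=> fC; have [] := gram_schmidt_orthonormal (row_free_inj fC).
set Q := gram_schmidt _ _ => QQ [W QW].
pose G := C *m C^T; have WGW : W^T *m (G *m W) = 1%:M.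
  by rewrite -QQ QW trmx_mul trmxK !mulmxA.
have WW : W *m W^T = invmx G.
  have uG := gram_unitmx fC.
  have := mulmx1C WGW => GWW; by rewrite -[LHS](mulKmx uG) -/G (mulmxA G W) GWW mulmx1.
pose Z := W^T *m (C *m T).
have dZ : gram_det Z = \det W ^+ 2 * gram_det (C *m T) by rewrite gram_det_mull det_tr.
have dG : \det W ^+ 2 * gram_det C = 1.
  by rewrite -(det1 R k) -WGW !det_mulmx det_tr /gram_det -/G expr2; ring.
have trZ : \tr (Z *m Z^T) = \tr (proj_rows C *m (T *m T^T)).
  have ZZ : Z^T *m Z = T^T *m (proj_rows C *m T).
    by rewrite /Z !trmx_mul trmxK /proj_rows -WW !mulmxA.
  by rewrite mxtrace_mulC ZZ mxtrace_mulC -mulmxA.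
have /andP[_] := gram_det_le_expR Z; rewrite trZ => le.
have -> : gram_det (C *m T) = gram_det C * gram_det Z.
  by rewrite dZ mulrA (mulrC (gram_det C)) dG mul1r.
by rewrite ler_wpM2l ?gram_det_ge0.
Qed.

End GramMatrices.

(** * Chains, their flags and primitivity *)

Section FlagsOfChains.
Context {R : realType} {n : nat} {lamc : seq nat}.
Local Notation m := (mdim lamc).

Lemma rspan_row k (C : 'M[R]_(k, n)) i : rspan C (row i C).
Proof. by exists (delta_mx 0 i); rewrite -rowE. Qed.

(** The right side [P] fixes the rows of [C] and has its own rows in their span; as [P] and the
    projection are both symmetric, these two facts force equality. *)
Lemma proj_rows_flag k (C : 'M[R]_(k, n)) (X : 'M[R]_(n, m)) :
  row_free C -> orthonormal_cols X -> colspan_first X k = rspan C ->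
  proj_rows C = X *m flag_diag k *m X^T.
Proof.
move=> fC XX E; set P := X *m _ *m _.
have uG := gram_unitmx fC.
have CP : C *m P = C.
  apply/row_matrixP => i; rewrite row_mul.
  have := rspan_row C i; rewrite -E => -[w [w0 ->]].
  rewrite /P !mulmxA -(mulmxA w) XX mulmx1; congr (_ *m _).
  apply/rowP => b; rewrite mxE (bigD1 b) //= big1 ?addr0 => [|c cb].
    rewrite !mxE eqxx /=; case: ltnP => kb; first by rewrite mulr1.
    by rewrite w0 // mul0r.
  by rewrite mxE (negbTE cb) mulr0.
have [V VC] : exists V, flag_diag k *m X^T = V *m C.
  have H (a : 'I_m) : exists v : 'rV[R]_k, row a (flag_diag k *m X^T) = v *m C.
    have : colspan_first X k (row a (flag_diag k *m X^T)).
      exists (row a (flag_diag k)); rewrite row_mul; split=> // j kj.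
      by rewrite !mxE; have [->|//] := eqVneq a j; rewrite ltnNge kj.
    by rewrite E.
  exists (\matrix_a sval (cid (H a))); apply/row_matrixP => a.
  by rewrite [RHS]row_mul rowK; exact: (svalP (cid (H a))).
have PE : P = X *m V *m C by rewrite /P -!mulmxA VC.
have CQ : C *m proj_rows C = C by rewrite /proj_rows !mulmxA mulmxV // mul1mx.
have PT : P^T = P by rewrite /P !trmx_mul trmxK flag_diagT mulmxA.
have QT : (proj_rows C)^T = proj_rows C.
  by rewrite /proj_rows !trmx_mul trmxK trmx_inv trmx_mul trmxK mulmxA.
have PQ : P *m proj_rows C = P by rewrite PE -mulmxA CQ.
have := congr1 trmx PQ; rewrite trmx_mul PT QT => <-.
by rewrite /proj_rows -[RHS]mulmxA CP.
Qed.

Lemma PiC_flag_form (C : @chainT R n lamc) (X : 'M[R]_(n, m)) :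
  (forall i, row_free (C i)) -> orthonormal_cols X ->
  flag_of_frame X = flag_of_chain C -> PiC C = flag_form X.
Proof.
move=> fC XX E; rewrite /flag_form /flag_weight mulmx_sumr mulmx_suml.
apply: eq_bigr => i _; apply: proj_rows_flag => //.
exact: (congr1 (fun F => F i) E).
Qed.

Lemma zspan_mulmx k (C : 'M[R]_(k, n)) (T : 'M[R]_n) :
  zspan (C *m T) = (fun v => v *m T) @` zspan C.
Proof.
apply/seteqP; split=> [v [z ->]|_ [_ [z ->] <-]].
  by exists (map_mx intr z *m C); [exists z|rewrite mulmxA].
by exists z; rewrite mulmxA.
Qed.

Lemma is_chain_mul (B T : 'M[R]_n) (C : @chainT R n lamc) : T \in unitmx ->
  is_chain B C -> is_chain (B *m T) (fun i => C i *m T).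
Proof.
move=> uT [fC [CB CC]]; split; [|split].
- move=> i; rewrite /row_free mxrankMfree //; first exact: fC.
  by rewrite row_free_unit.
- by move=> i; rewrite /lattice_of !zspan_mulmx; apply: image_subset; exact: CB.
- by move=> i j ij; rewrite !zspan_mulmx; apply: image_subset; exact: CC.
Qed.

Lemma chain_value_ge0 (B : 'M[R]_n) (C : @chainT R n lamc) : 0 <= chain_value B C.
Proof.
by rewrite divr_ge0 ?powR_ge0 //; apply: prodr_ge0 => i _; exact: gram_det_ge0.
Qed.

Lemma gamma_le (B : 'M[R]_n) (C : @chainT R n lamc) :
  is_chain B C -> gamma lamc B <= chain_value B C.
Proof.
move=> cC; apply: ge_inf; last by exists C.
by exists 0 => _ [C' [_ ->]]; exact: chain_value_ge0.
Qed.

Lemma sum_part : (\sum_(i < size lamc) part i)%N = sumn lamc.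
Proof. by rewrite sumnE (big_nth 0%N) big_mkord. Qed.

Lemma trace_PiC (C : @chainT R n lamc) :
  (forall i, row_free (C i)) -> \tr (PiC C) = (sumn lamc)%:R.
Proof.
move=> fC; rewrite raddf_sum /= -sum_part natr_sum; apply: eq_bigr => i _.
exact: trace_proj_rows.
Qed.

(** The exponent [|lambda| / n] makes the value homogeneous of degree 0; this permits normalising a
    nearby basis by a trace condition. *)
Lemma chain_value_scale (B : 'M[R]_n) (C : @chainT R n lamc) (a : R) :
  (0 < n)%N -> 0 < a -> chain_value (a *: B) (fun i => a *: C i) = chain_value B C.
Proof.
move=> n0 a0; rewrite /chain_value.
have gZ k (D : 'M[R]_(k, n)) : gram_det (a *: D) = (a ^+ 2) ^+ k * gram_det D.
  by rewrite /gram_det linearZ /= -scalemxAl -scalemxAr scalerA -expr2 detZ.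
under eq_bigr do rewrite gZ.
rewrite big_split /= prodrXr sum_part gZ powRM ?gram_det_ge0 ?exprn_ge0 ?(ltW a0) //.
have -> : ((a ^+ 2) ^+ n) `^ ((sumn lamc)%:R / n%:R) = (a ^+ 2) ^+ sumn lamc.
  rewrite -powR_mulrn ?sqr_ge0 // -powRrM mulrCA divff ?mulr1 ?powR_mulrn ?sqr_ge0 //.
  by rewrite pnatr_eq0 -lt0n.
rewrite -mulf_div divff ?mul1r //; first by rewrite expf_neq0 // expf_neq0 // gt_eqF.

Qed.

(** By the Smith form the integer coordinates of [C] in the basis [B] are [L *m De *m P *m U]. The
    first [k] rows of the unimodular [U] give the basis [S] of the saturation, and [K = L *m De] has
    the index as its determinant, up to sign. *)
Lemma saturation k (B : 'M[R]_n) (C : 'M[R]_(k, n)) :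
  B \in unitmx -> row_free C -> zspan C `<=` lattice_of B ->
  exists (K : 'M[int]_k) (S : 'M[R]_(k, n)),
    [/\ row_free S, C = map_mx intr K *m S &
        zspan S = lattice_of B `&` rspan C].
Proof.
move=> uB fC CB.
have [Z CE] : exists Z : 'M[int]_(k, n), C = map_mx intr Z *m B.
  have H i : exists z : 'rV[int]_n, row i C = map_mx intr z *m B.
    apply: CB; exists (delta_mx 0 i); rewrite rowE; congr (_ *m _).
    by apply/matrixP => a b; rewrite !mxE; case: (_ && _).
  exists (\matrix_i sval (cid (H i))); apply/row_matrixP => i.
  by rewrite row_mul -map_row rowK; exact: (svalP (cid (H i))).
have [L uL [U uU [d _ ZE]]] := int_Smith_normal_form Z.
pose De : 'M[int]_k := \matrix_(i, j) (d`_i *+ (i == j)).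
pose P : 'M[int]_(k, n) := pid_mx k.
have DP : (\matrix_(i, j) (d`_i *+ (i == j :> nat)) : 'M[int]_(k, n)) = De *m P.
  apply/matrixP => i j; rewrite !mxE (bigD1 i) //= big1 ?addr0 => [|c ci].
    by rewrite !mxE eqxx ltn_ord andbT mulr1n mulr_natr.
  by rewrite !mxE eq_sym (negbTE ci) mulr0n mul0r.
have kn : (k <= n)%N by move: fC; rewrite /row_free => /eqP <-; exact: rank_leq_col.
pose K := L *m De; pose S : 'M[R]_(k, n) := map_mx intr (P *m U) *m B.
have CKS : C = map_mx intr K *m S.
  by rewrite CE /S mulmxA -map_mxM ZE DP /K !mulmxA.
have fK : row_free (map_mx intr K : 'M[R]_k).
  rewrite /row_free eqn_leq rank_leq_row /= -{1}(eqP fC) CKS mxrankM_maxl //.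
have uK : (map_mx intr K : 'M[R]_k) \in unitmx by rewrite -row_free_unit.
have fS : row_free S.
  by rewrite /row_free eqn_leq rank_leq_row /= -{1}(eqP fC) CKS mxrankM_maxr.
exists K, S; split=> //; apply/seteqP; split=> [v [z ->]|v [[z ->] [w zw]]].
  split; first by exists (z *m (P *m U)); rewrite map_mxM /S mulmxA.
  exists (map_mx intr z *m invmx (map_mx intr K)).
  by rewrite CKS (mulmxA _ _ S) mulmxKV.
have uUR : (map_mx intr U : 'M[R]_n) \in unitmx.
  by rewrite unitmxE det_map_mx rmorph_unit // -unitmxE.
pose y := z *m invmx U.
have yE : map_mx intr y = w *m map_mx intr K *m map_mx intr P :> 'rV[R]_n.
  have zE : map_mx intr z = w *m map_mx intr K *m map_mx intr (P *m U) :> 'rV[R]_n.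
    by apply: (can_inj (mulmxK uB)); rewrite zw {1}CKS /S !mulmxA.
  apply: (can_inj (mulmxK uUR)).
  by rewrite -map_mxM /y mulmxKV // zE [map_mx _ (P *m U)]map_mxM mulmxA.
(* The coordinates [w *m K] of [v] in the basis [S] are the first [k] entries of the integer vector
   [z *m invmx U], hence integers. *)
exists (y *m P^T); rewrite zw {1}CKS mulmxA; congr (_ *m _).
transitivity (map_mx intr (y *m P^T) : 'rV[R]_k); last by [].
have PP : map_mx intr P *m map_mx intr P^T = 1%:M :> 'M[R]_k.
  by rewrite -map_mxM /P tr_pid_mx pid_mx_id // pid_mx_1 map_mx1.
have -> : map_mx intr (y *m P^T) = map_mx intr y *m map_mx intr P^T :> 'rV[R]_k.
  by rewrite map_mxM.
by rewrite yE -(mulmxA (w *m map_mx intr K)) PP mulmx1.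
Qed.

Lemma rspan_subset k l (C : 'M[R]_(k, n)) (D : 'M[R]_(l, n)) :
  zspan C `<=` zspan D -> rspan C `<=` rspan D.
Proof.
move=> CD _ [w ->].
have H i : exists z : 'rV[int]_l, row i C = map_mx intr z *m D.
  apply: CD; exists (delta_mx 0 i); rewrite rowE; congr (_ *m _).
  by apply/matrixP => a b; rewrite !mxE; case: (_ && _).
exists (w *m map_mx intr (\matrix_i sval (cid (H i)))).
rewrite -mulmxA; congr (_ *m _); apply/row_matrixP => i.
by rewrite row_mul -map_row rowK; exact: (svalP (cid (H i))).
Qed.

(** Saturating all lattices of a chain gives a chain again and divides the product of Gram
    determinants by the squares of the indices, which are at least 1; minimality leaves only index
    1. Thus a minimal chain is a function of its flag. *)
Lemma minimal_chain_primitive (B : 'M[R]_n) (C : @chainT R n lamc) i :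
  B \in unitmx -> minimal_chain B C -> zspan (C i) = lattice_of B `&` rspan (C i).
Proof.
move=> uB [[fC [CB CC]] vC].
pose sat i := saturation uB (fC i) (@CB i).
pose K i := sval (cid (sat i)).
pose S : chainT R n lamc := fun i => sval (cid (svalP (cid (sat i)))).
have KS j : [/\ row_free (S j), C j = map_mx intr (K j) *m S j &
   zspan (S j) = lattice_of B `&` rspan (C j)].
  exact: (svalP (cid (svalP (cid (sat j))))).
have cS : is_chain B S.
  split; first by move=> j; have [] := KS j.
  split=> [j|a b ab]; first by have [_ _ ->] := KS j; move=> v [].
  have [_ _ ->] := KS a; have [_ _ ->] := KS b.
  by move=> v [vB vC']; split=> //; apply: rspan_subset vC'; exact: CC.
have gE j : gram_det (C j) = ((\det (K j))%:~R : R) ^+ 2 * gram_det (S j).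
  by have [_ CE _] := KS j; rewrite (congr1 (@gram_det R _ _) CE) gram_det_mull det_map_mx.
have detK j : 1 <= ((\det (K j))%:~R : R) ^+ 2.
  have : (\det (K j))%:~R != 0 :> R.
    have := gram_det_gt0 (fC j); rewrite gE; apply: contraTneq => ->.
    by rewrite expr0n mul0r ltxx.
  rewrite intr_eq0 => d0; rewrite -rmorphXn /= -[1]/(1%:~R) ler_int.
  by rewrite -gtz0_ge1 exprn_even_gt0.
have gB : 0 < gram_det B.
  by apply: gram_det_gt0; rewrite row_free_unit.
have pS : 0 < \prod_j gram_det (S j).
  by apply: prodr_gt0 => j _; apply: gram_det_gt0; have [] := KS j.
have prod_le : \prod_j ((\det (K j))%:~R : R) ^+ 2 <= 1.
  have := gamma_le cS; rewrite -vC /chain_value ler_pM2r ?invr_gt0 ?powR_gt0 //.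
  by under eq_bigr do rewrite gE; rewrite big_split /= ger_pMl.
have Ki : ((\det (K i))%:~R : R) ^+ 2 = 1.
  apply/eqP; rewrite eq_le detK andbT; apply: le_trans prod_le.
  rewrite [leRHS](bigD1 i) //= ler_peMr ?sqr_ge0 //.
  by elim/big_ind: _ => // x y x1 y1; exact: mulr_ege1.
have uK : K i \in unitmx.
  rewrite unitmxE; move: Ki; rewrite -rmorphXn /= => /eqP.
  rewrite -[1]/(1%:~R) eqr_int sqrf_eq1 => /orP[] /eqP ->; rewrite ?unitrN ?unitr1 //.
have [_ CE <-] := KS i; apply/seteqP; split=> [v [z ->]|v [z ->]].
  by exists (z *m K i); rewrite {1}CE map_mxM mulmxA.
exists (z *m invmx (K i)); rewrite {1}CE mulmxA -map_mxM mulmxKV //.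
Qed.

End FlagsOfChains.

(** * Perturbation estimates and local maximality *)

Section Extremality.
Context {R : realType} {n : nat}.
Implicit Types (A H T : 'M[R]_n).

(** The entrywise l1 norm is submultiplicative, invariant under transposition and bounds the trace,
    as the estimates require. *)
Definition nrm1 A : R := \sum_i \sum_j `|A i j|.

Lemma nrm1_ge0 A : 0 <= nrm1 A.
Proof. by apply: sumr_ge0 => i _; apply: sumr_ge0. Qed.

Lemma nrm1_le A c : (forall i j, `|A i j| <= c) -> nrm1 A <= (n * n)%:R * c.
Proof.
move=> Ac; apply: (@le_trans _ _ (\sum_(i < n) \sum_(j < n) c)).
  by apply: ler_sum => i _; apply: ler_sum => j _.
by rewrite !sumr_const !card_ord -mulrnA mulr_natl.
Qed.

Lemma nrm1D A B : nrm1 (A + B) <= nrm1 A + nrm1 B.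
Proof.
rewrite /nrm1 -big_split; apply: ler_sum => i _ /=; rewrite -big_split.
by apply: ler_sum => j _; rewrite mxE; exact: ler_normD.
Qed.

Lemma nrm1Z a A : nrm1 (a *: A) = `|a| * nrm1 A.
Proof.
rewrite /nrm1 mulr_sumr; apply: eq_bigr => i _; rewrite mulr_sumr; apply: eq_bigr => j _.
by rewrite mxE normrM.
Qed.

Lemma nrm1N A : nrm1 (- A) = nrm1 A.
Proof. by rewrite -scaleN1r nrm1Z normrN normr1 mul1r. Qed.

Lemma nrm1T A : nrm1 A^T = nrm1 A.
Proof.
by rewrite /nrm1 exchange_big; apply: eq_bigr => i _; apply: eq_bigr => j _; rewrite mxE.
Qed.

Lemma nrm1_scalar a : nrm1 a%:M = n%:R * `|a|.
Proof.
rewrite /nrm1 (eq_bigr (fun=> `|a|)) ?sumr_const ?card_ord ?mulr_natl // => i _.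
rewrite (bigD1 i) //= big1 => [|j ji]; first by rewrite mxE eqxx mulr1n addr0.
by rewrite mxE eq_sym (negbTE ji) normr0.
Qed.

Lemma nrm1M A B : nrm1 (A *m B) <= nrm1 A * nrm1 B.
Proof.
rewrite {2}/nrm1 mulr_suml; apply: ler_sum => i _.
rewrite mulr_suml.
apply: (@le_trans _ _ (\sum_j \sum_k `|A i k| * `|B k j|)).
  apply: ler_sum => j _; rewrite mxE; apply: le_trans (ler_norm_sum _ _ _) _.
  by apply: ler_sum => k _; rewrite normrM.
rewrite exchange_big; apply: ler_sum => k _ /=; rewrite -mulr_sumr ler_wpM2l //.
by rewrite [leRHS](bigD1 k) //= lerDl; apply: sumr_ge0 => l _; apply: sumr_ge0.
Qed.

Lemma nrm1_tr A : `|\tr A| <= nrm1 A.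
Proof.
apply: le_trans (ler_norm_sum _ _ _) _; apply: ler_sum => i _.
by rewrite (bigD1 i) //= lerDl; apply: sumr_ge0.
Qed.

(* Since [J = 1 - H + H *m H *m J] for the inverse [J] of [1 + H], its trace deviates
   from [n] only to second order when [H] has trace zero. *)
Lemma trace_invmx_le A H : A \in unitmx -> A = 1%:M + H -> \tr H = 0 -> nrm1 H <= 2^-1 ->
  \tr (invmx A) - n%:R <= 2 * n%:R * nrm1 H ^+ 2.
Proof.
move=> uA AE trH H2; set J := invmx A.
have J1 : J = 1%:M - H *m J.
  by rewrite -(mulmxV uA) -/J AE mulmxDl mul1mx addrK.
have J2 : J = 1%:M - H + H *m H *m J.
  by rewrite {1}J1 {1}J1 mulmxBr mulmx1 opprB mulmxA addrA addrAC.
have h0 := nrm1_ge0 H; have j0 := nrm1_ge0 J.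
have jn : nrm1 J <= 2 * n%:R.
  have : nrm1 J <= n%:R + nrm1 H * nrm1 J.
    rewrite {1}J1; apply: le_trans (nrm1D _ _) _.
    by rewrite nrm1_scalar normr1 mulr1 nrm1N lerD2l nrm1M.
  have : nrm1 H * nrm1 J <= 2^-1 * nrm1 J by rewrite ler_wpM2r.
  lra.
rewrite J2 !raddfD /= mxtrace1 raddfN /= trH subr0 addrAC subrr add0r.
apply: le_trans (ler_norm _) _; apply: le_trans (nrm1_tr _) _.
apply: le_trans (nrm1M _ _) _; apply: (@le_trans _ _ (nrm1 H * nrm1 H * nrm1 J)).
  by rewrite ler_wpM2r // nrm1M.
by rewrite expr2 mulrC ler_wpM2r // mulr_ge0.
Qed.

(** The numerator is bounded by the determinant inequality for each [C i *m T], the denominator by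
    the same inequality for the inverse of [T]. If [A = T *m T^T = 1 + H] with [H] of trace 0, the
    second term of the hypothesis is [|lambda| / n] times the trace of [H^2 A^-1]. *)
Lemma chain_value_perturb (lamc : seq nat) (B T : 'M[R]_n) (C : @chainT R n lamc) :
  (0 < n)%N -> B \in unitmx -> T \in unitmx -> (forall i, row_free (C i)) ->
  \tr (PiC C *m (T *m T^T - 1%:M)) +
    (sumn lamc)%:R / n%:R * (\tr (invmx (T *m T^T)) - n%:R) <= 0 ->
  chain_value (B *m T) (fun i => C i *m T) <= chain_value B C.
Proof.
move=> n0 uB uT fC le0; set r := (sumn lamc)%:R / n%:R in le0 *.
set A := T *m T^T in le0 *.
have r0 : 0 <= r by rewrite divr_ge0.
have uTT : T^T \in unitmx by rewrite unitmx_tr.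
have uA : A \in unitmx by rewrite unitmx_mul uT.
have dA : \det A = gram_det T by [].
have invA : (invmx T)^T *m ((invmx T)^T)^T = invmx A.
  rewrite trmxK; apply: (can_inj (mulmxK uA)); rewrite mulVmx // /A -mulmxA.
  by rewrite (mulmxA (invmx T)) mulVmx // mul1mx trmx_inv mulVmx.
have dI : \det (invmx A) = gram_det (invmx T)^T by rewrite /gram_det invA.
have prod_le : \prod_i gram_det (C i *m T) <=
    (\prod_i gram_det (C i)) * expR (\tr (PiC C *m (A - 1%:M))).
  apply: (@le_trans _ _
    (\prod_i (gram_det (C i) * expR (\tr (proj_rows (C i) *m A) - (part i)%:R)))).
    apply: ler_prod => i _; rewrite gram_det_ge0 /=; exact: gram_det_mul_le.
  rewrite big_split /= -expR_sum ler_wpM2l //.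
    by apply: prodr_ge0 => i _; exact: gram_det_ge0.
  rewrite ler_expR sumrB -natr_sum sum_part mulmxBr mulmx1 raddfB /= trace_PiC //.
  by rewrite /PiC mulmx_suml raddf_sum /=.
have gBT : gram_det (B *m T) = gram_det B * \det A.
  by rewrite /gram_det /A trmx_mul !mulmxA !det_mulmx !det_tr; ring.
have dA0 : 0 < \det A by rewrite dA; apply: gram_det_gt0; rewrite row_free_unit.
have gB0 : 0 < gram_det B by apply: gram_det_gt0; rewrite row_free_unit.
have dAI : \det A * \det (invmx A) = 1 by rewrite -det_mulmx mulmxV // det1.
have dI0 : 0 <= \det (invmx A) by rewrite dI gram_det_ge0.
have inv_le : (\det A `^ r)^-1 <= expR (r * (\tr (invmx A) - n%:R)).
  have -> : (\det A `^ r)^-1 = \det (invmx A) `^ r.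
    have p0 : \det A `^ r != 0 by rewrite gt_eqF // powR_gt0.
    by apply: (mulfI p0); rewrite divff // -powRM ?(ltW dA0) // dAI powR1.
  rewrite mulrC expRM; apply: ge0_ler_powR => //; rewrite ?nnegrE ?expR_ge0 //.
  by have /andP[_] := gram_det_le_expR (invmx T)^T; rewrite -dI invA.
rewrite /chain_value gBT powRM ?(ltW dA0) ?(ltW gB0) // invfM mulrA mulrAC.
rewrite ler_wpM2r ?invr_ge0 ?powR_ge0 //.
apply: le_trans (ler_pM _ _ prod_le inv_le) _.
- by apply: prodr_ge0 => i _; exact: gram_det_ge0.
- by rewrite invr_ge0 powR_ge0.
rewrite -mulrA -expRD -[leRHS]mulr1 ler_wpM2l //.
  by apply: prodr_ge0 => i _; exact: gram_det_ge0.
by rewrite -[X in _ <= X]expR0 ler_expR.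
Qed.

(** As the sum is 0, the sum of absolute values is that of [|x i| - x i], and each of these [k]
    terms is at most [- 2] times the minimum. *)
Lemma exists_negative_part k (x : 'I_k -> R) : (0 < k)%N -> \sum_j x j = 0 ->
  exists j, x j <= - (\sum_j `|x j|) / (2 * k%:R).
Proof.
move=> k0 sx; pose j0 := Ordinal k0.
have [j _ jmin] := @arg_minP _ _ _ j0 xpredT x isT.
exists j; have k0' : 0 < (k%:R : R) by rewrite ltr0n.
have xj0 : x j <= 0.
  have : k%:R * x j <= 0.
    rewrite -sx mulr_natl -[in leLHS](card_ord k) -sumr_const.
    by apply: ler_sum => i _; exact: jmin.
  by rewrite pmulr_rle0.
rewrite ler_pdivlMr ?mulr_gt0 // lerNr.
have -> : \sum_i `|x i| = \sum_i (`|x i| - x i) by rewrite sumrB sx subr0.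
apply: (@le_trans _ _ (\sum_(i < k) (- (2 * x j)))).
  apply: ler_sum => i _; have := jmin i isT.
  by case: (ger0P (x i)) => *; lra.
by rewrite sumr_const card_ord -[leLHS]mulr_natr; lra.
Qed.

(** Spanning bounds every entry of [H] by the numbers [\tr (Pi j *m H)], so these cannot all be
    small; the scalar sum makes them add up to 0, so one of them is correspondingly negative. *)
Lemma negative_direction k (Pi : 'I_k -> 'M[R]_n) (s : R) : (0 < k)%N ->
  (forall M, M^T = M -> exists a : 'I_k -> R, M = \sum_j a j *: Pi j) ->
  \sum_j Pi j = s%:M ->
  exists2 d, 0 < d & forall H, H^T = H -> \tr H = 0 ->
    exists j, \tr (Pi j *m H) <= - (d * nrm1 H).
Proof.
move=> k0 span sumPi.
have symE (p : 'I_n * 'I_n) : exists a : 'I_k -> R,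
    delta_mx p.1 p.2 + delta_mx p.2 p.1 = \sum_j a j *: Pi j.
  by apply: span; rewrite linearD /= !trmx_delta addrC.
pose a p := sval (cid (symE p)).
(* Total size of the coefficients of the symmetrised matrix units; the summand 1 keeps [K]
   positive. *)
pose K : R := \sum_p \sum_j `|a p j| + 1.
have K0 : 0 < K by rewrite ltr_wpDl // sumr_ge0 // => p _; rewrite sumr_ge0.
exists (K * (2 * k%:R))^-1.
  by rewrite invr_gt0 !mulr_gt0 // ltr0n.
move=> H HT trH; pose x j := \tr (Pi j *m H).
have sx : \sum_j x j = 0.
  by rewrite -raddf_sum /= -mulmx_suml sumPi mul_scalar_mx linearZ /= trH mulr0.
have [j xj] := exists_negative_part k0 sx; exists j.
set t := \sum_j _ in xj.
have t0 : 0 <= t by rewrite sumr_ge0.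
have Hle : nrm1 H <= K * t.
  have ent p : `|H p.1 p.2| <= (\sum_j `|a p j|) * t.
    have trd u v : \tr (delta_mx u v *m H) = H v u.
      rewrite mxtrace_mulC -(mulr1 (H v u)) /mxtrace (bigD1 v) //= big1 ?addr0 => [|c cv].
        rewrite mxE (bigD1 u) //= big1 ?addr0 => [|e eu]; first by rewrite mxE !eqxx.
        by rewrite mxE (negbTE eu) mulr0.
      by rewrite mxE big1 // => e _; rewrite mxE (negbTE cv) andbF mulr0.
    have : \tr ((delta_mx p.1 p.2 + delta_mx p.2 p.1) *m H) = 2 * H p.1 p.2.
      have Hs : H p.2 p.1 = H p.1 p.2 by rewrite -{1}HT mxE.
      by rewrite mulmxDl raddfD /= !trd Hs; ring.
    rewrite (svalP (cid (symE p))) -/(a p) mulmx_suml raddf_sum /= => E.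
    have : `|2 * H p.1 p.2| <= (\sum_j `|a p j|) * t.
      rewrite -E; apply: le_trans (ler_norm_sum _ _ _) _.
      rewrite mulr_suml; apply: ler_sum => i _.
      rewrite -scalemxAl linearZ /= normrM ler_wpM2l // /t (bigD1 i) //= lerDl.
      by rewrite sumr_ge0.
    by rewrite normrM ger0_norm //; have := normr_ge0 (H p.1 p.2); lra.
  rewrite /nrm1 pair_bigA /=; apply: (@le_trans _ _ (\sum_p (\sum_j `|a p j|) * t)).
    by apply: ler_sum => p _; exact: ent.
  by rewrite -mulr_suml ler_wpM2r // /K lerDl.
apply: le_trans xj _; rewrite mulNr lerN2 invfM mulrAC.
rewrite ler_wpM2r ?invr_ge0 ?mulr_ge0 //.
by rewrite mulrC ler_pdivrMr // mulrC.
Qed.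

Lemma extreme_of_spanning (lamc : seq nat) (B : 'M[R]_n) k (Cs : 'I_k -> @chainT R n lamc) s :
  (0 < n)%N -> (0 < k)%N -> B \in unitmx -> (forall j, minimal_chain B (Cs j)) ->
  (forall M, M^T = M -> exists a : 'I_k -> R, M = \sum_j a j *: PiC (Cs j)) ->
  \sum_j PiC (Cs j) = s%:M -> extreme lamc B.
Proof.
move=> n0 k0 uB minC span sumPi.
have [d d0 neg] := negative_direction k0 span sumPi.
have n0R : 0 < (n%:R : R) by rewrite ltr0n.
pose l : R := (sumn lamc)%:R.
have l0 : 0 <= l by [].
have core T : T \in unitmx -> \tr (T *m T^T - 1%:M) = 0 ->
    nrm1 (T *m T^T - 1%:M) <= 2^-1 -> nrm1 (T *m T^T - 1%:M) * (2 * (l + 1)) <= d ->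
    exists j, chain_value (B *m T) (fun i => Cs j i *m T) <= gamma lamc B.
  move=> uT; set H := T *m T^T - 1%:M => trH H2 Hd.
  have HT : H^T = H by rewrite /H linearB /= trmx_mul trmxK trmx1.
  have [j tj] := neg H HT trH; exists j.
  have [[fC _] <-] := minC j.
  apply: chain_value_perturb => //; rewrite -/H -/l.
  have uA : T *m T^T \in unitmx by rewrite unitmx_mul unitmx_tr uT.
  have AE : T *m T^T = 1%:M + H by rewrite /H addrC subrK.
  have tle := trace_invmx_le uA AE trH H2.
  have h0 := nrm1_ge0 H.
  have : l / n%:R * (\tr (invmx (T *m T^T)) - n%:R) <= l / n%:R * (2 * n%:R * nrm1 H ^+ 2).
    by rewrite ler_wpM2l // divr_ge0 // ltW.
  have -> : l / n%:R * (2 * n%:R * nrm1 H ^+ 2) = 2 * l * nrm1 H * nrm1 H.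
    by field; rewrite gt_eqF.
  have : 2 * l * nrm1 H * nrm1 H <= d * nrm1 H by rewrite ler_wpM2r //; nra.
  lra.
pose b := nrm1 (invmx B); have b0 : 0 <= b by exact: nrm1_ge0.
(* The first bound feeds [trace_invmx_le]; the second keeps the quadratic term [2 * l * nrm1 H ^+ 2]
   below [d * nrm1 H]. *)
pose del := Num.min (2^-1) (d / (2 * (l + 1))).
have del0 : 0 < del by rewrite lt_min invr_gt0 ltr0n /= divr_gt0 //; lra.
(* [6^-1] yields [nrm1 F <= 3 * eta <= 2^-1], which keeps [n + \tr F] away from 0; the other bound
   turns the later estimate [nrm1 H <= 6 * (n + 1) * eta] into [nrm1 H <= del]. *)
pose eta := Num.min (6^-1) (del / (6 * (n%:R + 1))).
have eta0 : 0 < eta by rewrite lt_min invr_gt0 ltr0n /= divr_gt0 // mulr_gt0 ?ltr0n // ltr_wpDl.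
have nn0 : 0 < ((n * n)%:R : R) by rewrite ltr0n muln_gt0 n0.
have bb0 : 0 < b + 1 by rewrite ltr_wpDl.
have aux (N x e : R) : - (3 * e) <= x <= 3 * e -> 2^-1 <= N + x -> `|N / (N + x) - 1| <= 6 * e.
  move=> xe Nx; have Nx0 : N + x != 0 by rewrite gt_eqF //; lra.
  have -> : N / (N + x) - 1 = - x / (N + x) by field.
  rewrite normrM normrN normfV (ger0_norm (x := N + _)); last by lra.
  have : `|x| <= 3 * e by rewrite ler_norml.
  by rewrite ler_pdivrMr; [have := normr_ge0 x; nra|lra].
(* The factor [n * n] passes from entrywise closeness to [nrm1], and [b + 1] absorbs the
   multiplication by [invmx B]. *)
exists (eta / ((n * n)%:R * (b + 1))); split; first by rewrite divr_gt0 // mulr_gt0.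
move=> B' uB' close; set e := eta / _ in close.
pose T0 := invmx B *m B'; pose E := invmx B *m (B' - B).
have uT0 : T0 \in unitmx by rewrite unitmx_mul unitmx_inv uB.
have BT0 : B *m T0 = B' by rewrite mulKVmx.
have T0E : T0 = 1%:M + E by rewrite /E mulmxBr mulVmx // addrC subrK.
have E_le : nrm1 E <= eta.
  apply: le_trans (nrm1M _ _) _.
  have De : nrm1 (B' - B) <= (n * n)%:R * e.
    by apply: nrm1_le => i j; have := close i j; rewrite !mxE => /ltW.
  have -> : eta = (b + 1) * ((n * n)%:R * e) by rewrite /e; field; rewrite !gt_eqF.
  apply: ler_pM => //; first exact: nrm1_ge0.
  by rewrite lerDl.
pose F := E + E^T + E *m E^T.
have AF : T0 *m T0^T = 1%:M + F.
  rewrite T0E linearD /= trmx1 mulmxDl mul1mx mulmxDr mulmx1 /F.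
  by rewrite -!addrA; congr (_ + _); rewrite !addrA; congr (_ + _); exact: addrC.
have eta6 : eta <= 6^-1 by rewrite ge_min lexx.
have F_le : nrm1 F <= 3 * eta.
  have e0 := nrm1_ge0 E.
  have : nrm1 F <= nrm1 E + nrm1 E + nrm1 E * nrm1 E.
    apply: le_trans (nrm1D _ _) _; apply: lerD.
      by apply: le_trans (nrm1D _ _) _; rewrite nrm1T.
    by apply: le_trans (nrm1M _ _) _; rewrite nrm1T.
  nra.
have trF : `|\tr F| <= 3 * eta := le_trans (nrm1_tr F) F_le.
have n1 : 1 <= (n%:R : R) by rewrite ler1n.
have trF_b : - (3 * eta) <= \tr F <= 3 * eta by rewrite -ler_norml.
have den0 : 2^-1 <= n%:R + \tr F by lra.
(* The factor that gives [T *m T^T] trace [n]; scaling lattice and chain together preserves the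
   value. *)
pose tau := n%:R / (n%:R + \tr F).
have tau0 : 0 < tau by rewrite divr_gt0 //; lra.
have tau1 : `|tau - 1| <= 6 * eta.
  by apply: aux.
have tau2 : tau <= 2.
  have := ler_norm (tau - 1); lra.
pose T := Num.sqrt tau *: T0.
have sq : 0 < Num.sqrt tau by rewrite sqrtr_gt0.
have uT : T \in unitmx by rewrite unitmxZ // unitfE gt_eqF.
have TT : T *m T^T = tau *: (1%:M + F).
  by rewrite /T linearZ /= -scalemxAl -scalemxAr scalerA -expr2 sqr_sqrtr ?ltW // AF.
have HE : T *m T^T - 1%:M = (tau - 1)%:M + tau *: F.
  by rewrite TT scalerDr scalemx1 raddfB /= addrAC.
have trH : \tr (T *m T^T - 1%:M) = 0.
  rewrite HE raddfD /= mxtraceZ mxtrace_scalar -mulr_natr /tau; field.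
  by rewrite gt_eqF // (lt_le_trans _ den0) // invr_gt0.
have H_le : nrm1 (T *m T^T - 1%:M) <= del.
  apply: (@le_trans _ _ (6 * (n%:R + 1) * eta)); last first.
    have : eta <= del / (6 * (n%:R + 1)) by rewrite ge_min lexx orbT.
    by rewrite ler_pdivlMr ?mulr_gt0 ?ltr0n // ?ltr_wpDl // mulrC.
  rewrite HE; apply: le_trans (nrm1D _ _) _; rewrite nrm1_scalar nrm1Z (gtr0_norm tau0).
  have : n%:R * `|tau - 1| <= n%:R * (6 * eta) by rewrite ler_wpM2l.
  have : tau * nrm1 F <= 2 * (3 * eta) by apply: ler_pM => //; [exact: ltW|exact: nrm1_ge0].
  lra.
have [||j] := core T uT trH.
- by apply: le_trans H_le _; rewrite ge_min lexx.
- rewrite -ler_pdivlMr; last by lra.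
  by apply: le_trans H_le _; rewrite ge_min lexx orbT.
have -> : B *m T = Num.sqrt tau *: B' by rewrite /T -scalemxAr BT0.
have -> : (fun i => Cs j i *m T) = (fun i => Num.sqrt tau *: (Cs j i *m T0)).
  by apply: functional_extensionality_dep => i; rewrite -scalemxAr.
rewrite (chain_value_scale B' (fun i => Cs j i *m T0) n0 sq) => le_j.
have cB' : is_chain B' (fun i => Cs j i *m T0).
  by rewrite -BT0; apply: is_chain_mul uT0 _; have [] := minC j.
exact: le_trans (gamma_le cB') le_j.
Qed.

End Extremality.

Theorem mainTheorem6 (R : realType) (n : nat) (lamc : seq nat) (B : 'M[R]_n) :
  (0 < size lamc)%N ->
  sorted geq lamc ->
  all (fun k => (0 < k < n)%N) lamc ->
  B \in unitmx ->
  @strongly_perfect R n lamc B ->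
  @extreme R n lamc B /\ @perfect R n lamc B /\ @strongly_eutactic R n lamc B.
Proof.
move=> lam0 _ lam_lt uB [k [Xs [orthX [minX [exhX [distX design]]]]]].
have /andP[m0 mn] := mdim_bounds lam0 lam_lt.
have k0 := design_nonempty design (ltnW mn).
pose Cs j := sval (cid (minX j)).
have minC j : minimal_chain B (Cs j) by have [] := svalP (cid (minX j)).
have flagC j : flag_of_frame (Xs j) = flag_of_chain (Cs j).
  by have [] := svalP (cid (minX j)).
have PiE j : PiC (Cs j) = flag_form (Xs j).
  by apply: PiC_flag_form => //; have [[]] := minC j.
have span M : M^T = M -> exists a : 'I_k -> R, M = \sum_j a j *: PiC (Cs j).
  move=> /(design_span design (ltnW mn) orthX lam0 lam_lt)[a ->].
  by exists a; apply: eq_bigr => j _; rewrite PiE.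
have [s s0 sumPi] := design_sum_scalar design (ltnW mn) orthX lam0 lam_lt.
have sumC : \sum_j PiC (Cs j) = s%:M by rewrite -sumPi; apply: eq_bigr.
have n0 : (0 < n)%N by exact: leq_ltn_trans mn.
split; [|split].
- exact: extreme_of_spanning sumC.
- by move=> M /span[a ME]; exists k, Cs, a.
- exists k, Cs, s^-1; split; first by rewrite invr_gt0.
  have flag_of_sublats (C C' : chainT R n lamc) :
      sublats C = sublats C' -> flag_of_chain C = flag_of_chain C'.
    move=> E; apply/funext => i; have Ei : zspan (C i) = zspan (C' i) := congr1 (fun F => F i) E.
    by apply/seteqP; split; apply: rspan_subset; rewrite Ei.
  split=> //; split; [|split].
  + by move=> j j' /flag_of_sublats E; apply: distX; rewrite !flagC.
  (* By primitivity, [C] and [Cs j] have the same lattices as soon as they have the same flag. *)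
  + move=> C mC; have [j Xj] := exhX C mC; exists j; apply/funext => i.
    rewrite /sublats (minimal_chain_primitive i uB (minC j)) (minimal_chain_primitive i uB mC).
    congr (_ `&` _).
    by have := congr1 (fun F => F i) (etrans (esym (flagC j)) Xj).
  + by rewrite sumC -mul_scalar_mx -scalar_mxM mulVf // gt_eqF.
Qed.
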